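(* Let $N\ge1$ be an integer. Then $\zeta_N(s)$ extends to a function analytic on the entire complex plane except for simple poles at $s\in\{2-N,3-N,\dots,1\}$, whose residues are $$\operatorname{Res}(\zeta_N(s),s=n)=(2-n)\binom{N}{2-n}B_{N,1-n}\qquad(2-N\le n\le 1).$$ Furthermore, for integers $n<2-N$, $$\zeta_N(n)=(-1)^{-n-N+1}\binom{1-n}{N}^{-1}B_{N,1-n}.$$
   Context: For an integer $M\ge0$, $T_M(x)=\sum_{k=0}^{M}\frac{x^k}{k!}$. For $N\ge1$, $\zeta_N(s)=\frac{1}{\Gamma(s+N-1)}\int_0^\infty \frac{x^{s+N-2}}{e^x-T_{N-1}(x)}\,dx$ for $\Re(s)>1$. The generalized Bernoulli numbers $B_{N,m}$ are defined by the power series expansion $$\frac{w^N/N!}{e^w-T_{N-1}(w)}=\sum_{m=0}^\infty \frac{B_{N,m}}{m!}w^m.$$ *)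

(* Defs.v *)
From Stdlib Require Import Reals ZArith Lra Lia.
From Coquelicot Require Import Coquelicot.
Open Scope R_scope.

Definition T (M : nat) (x : R) : R :=
  sum_f_R0 (fun k => x ^ k / INR (fact k)) M.

(* The point [w = 0], where the quotient is the meaningless [0 / 0], is
   excluded; the coefficients are determined by the punctured neighbourhood. *)
Definition is_gen_bernoulli (N : nat) (B : nat -> R) : Prop :=
  exists r : R, 0 < r /\
    forall w : R, 0 < Rabs w < r ->
      is_pseries (fun m => B m / INR (fact m)) w
        ((w ^ N / INR (fact N)) / (exp w - T (N - 1) w)).

(* [x ^ s = exp (s * ln x)], meant for [0 < x]. *)
Definition Rcpow (x : R) (s : C) : C :=
  (exp (Re s * ln x) * cos (Im s * ln x),
   exp (Re s * ln x) * sin (Im s * ln x)).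

Definition CInt_0_infty (f : R -> C) : C :=
  RInt_gen (V := C_R_CompleteNormedModule) f (at_right 0) (Rbar_locally p_infty).

(* Euler's integral: this is the Gamma function on [0 < Re s] only. *)
Definition Gamma (s : C) : C :=
  CInt_0_infty (fun x => (Rcpow x (s - 1) * RtoC (exp (- x)))%C).

(* Meant for [1 < Re s]. *)
Definition zeta (N : nat) (s : C) : C :=
  (/ Gamma (s + INR N - 1) *
   CInt_0_infty (fun x =>
     Rcpow x (s + INR N - 2) / RtoC (exp x - T (N - 1) x)))%C.

(* Analytic in the sense of one complex variable: complex differentiable on a
   whole neighbourhood of the point. *)
Definition analytic_at (f : C -> C) (a : C) : Prop :=
  locally a (fun z => @ex_derive C_AbsRing C_NormedModule f z).

(* The principal part of [f] at [a] is exactly [r / (z - a)], with [r <> 0]: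
   the singularity is not removable. *)
Definition simple_pole_residue (f : C -> C) (a r : C) : Prop :=
  r <> RtoC 0 /\
  exists h : C -> C, analytic_at h a /\
    locally' a (fun z => f z = (r / (z - a) + h z)%C).

Fixpoint ps_inv_aux (a : nat -> R) (m : nat) : nat -> R :=
  match m with
  | O => fun _ => 1
  | S m' => fun k =>
      if Nat.leb k m' then ps_inv_aux a m' k
      else - sum_f_R0 (fun j => ps_inv_aux a m' j * a (S m' - j)%nat) m'
  end.

Definition ps_inv (a : nat -> R) (m : nat) : R := ps_inv_aux a m m.

Lemma ps_inv_auxE a m k : (k <= m)%nat -> ps_inv_aux a m k = ps_inv a k.
Proof.
induction m as [|m IH]; intros Hk.
- replace k with 0%nat by lia; reflexivity.
- destruct (Nat.eq_dec k (S m)) as [->|Hn]; [reflexivity|].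
  simpl; rewrite (proj2 (Nat.leb_le k m)) by lia; apply IH; lia.
Qed.

Lemma ps_invS a m :
  ps_inv a (S m) = - sum_f_R0 (fun j => ps_inv a j * a (S m - j)%nat) m.
Proof.
unfold ps_inv at 1; cbn [ps_inv_aux].
rewrite (proj2 (Nat.leb_gt (S m) m)) by lia.
f_equal; apply sum_eq; intros i Hi; rewrite ps_inv_auxE by lia; reflexivity.
Qed.

Lemma ps_inv_bound (a : nat -> R) (a_le1 : forall k, Rabs (a k) <= 1) m :
  Rabs (ps_inv a m) <= 2 ^ m.
Proof.
induction m as [m IH] using (well_founded_induction lt_wf).
destruct m as [|m].
- unfold ps_inv; simpl; rewrite Rabs_R1; lra.
- rewrite (ps_invS a), Rabs_Ropp.
  eapply Rle_trans; [apply Rsum_abs|].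
  apply Rle_trans with (sum_f_R0 (fun j => 2 ^ j) m).
  + apply sum_Rle; intros j Hj; rewrite Rabs_mult.
    rewrite <- (Rmult_1_r (2 ^ j)).
    apply Rmult_le_compat; auto using Rabs_pos.
    apply IH; lia.
  + clear IH; assert (H : sum_f_R0 (fun j => 2 ^ j) m = 2 ^ S m - 1).
    { induction m as [|m IH]; [simpl; lra|].
      rewrite tech5, IH; simpl; lra. }
    rewrite H; lra.
Qed.

Lemma CV_radius_ge_half (b : nat -> R) (w : R) :
  (forall k, Rabs (b k) <= 2 ^ k) -> Rabs w < / 2 ->
  Rbar_lt (Rabs w) (CV_radius b).
Proof.
intros Hb Hw.
apply Rbar_lt_le_trans with (Finite (/ 2)); [exact Hw|].
apply (CV_radius_bounded b); exists 1; intros n.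
rewrite Rabs_mult, <- RPow_abs, (Rabs_pos_eq (/ 2)) by lra.
rewrite pow_inv.
apply Rmult_le_reg_r with (2 ^ n); [apply pow_lt; lra|].
rewrite Rmult_assoc, Rinv_l, Rmult_1_r, Rmult_1_l; [apply Hb|].
apply pow_nonzero; lra.
Qed.

Lemma ps_inv_series (a : nat -> R) (a0 : a 0%nat = 1)
  (a_le1 : forall k, Rabs (a k) <= 1) (w : R) : Rabs w < / 2 ->
  is_pseries (ps_inv a) w (/ PSeries a w) /\ PSeries a w <> 0.
Proof.
intros Hw.
assert (Ra : Rbar_lt (Rabs w) (CV_radius a)).
{ apply CV_radius_ge_half; [|exact Hw].
  intros k; apply Rle_trans with (1 := a_le1 k); apply pow_R1_Rle; lra. }
assert (Rc : Rbar_lt (Rabs w) (CV_radius (ps_inv a)))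
  by (apply CV_radius_ge_half; [apply ps_inv_bound; exact a_le1|exact Hw]).
assert (Sa := PSeries_correct a w (CV_radius_inside a w Ra)).
assert (Sc := PSeries_correct (ps_inv a) w (CV_radius_inside (ps_inv a) w Rc)).
assert (Sm := is_pseries_mult _ _ _ _ _ Sc Sa Rc Ra).
assert (H1 : PSeries (ps_inv a) w * PSeries a w = 1).
{ rewrite <- (is_pseries_unique _ _ _ Sm).
  rewrite (PSeries_ext _ (fun n => match n with O => 1 | S _ => 0 end)).
  - apply is_pseries_unique, filterlim_ext with (fun _ => 1);
      [|apply filterlim_const].
    intros n; rewrite sum_n_Reals; induction n as [|n IH]; simpl.
    + unfold scal, one; simpl; unfold mult; simpl; ring.
    + rewrite <- IH; unfold scal; simpl; unfold mult; simpl; ring.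
  - intros [|n]; unfold PS_mult.
    + simpl; rewrite a0; unfold ps_inv; simpl; ring.
    + rewrite tech5, ps_invS, Nat.sub_diag, a0; ring. }
assert (Hn : PSeries a w <> 0) by (intros E; rewrite E in H1; lra).
split; [|exact Hn].
replace (/ PSeries a w) with (PSeries (ps_inv a) w); [exact Sc|].
apply Rmult_eq_reg_r with (PSeries a w); [|exact Hn].
rewrite H1, Rinv_l; auto.
Qed.

Lemma ex_gen_bernoulli (N : nat) : (1 <= N)%nat ->
  exists B, is_gen_bernoulli N B.
Proof.
intros HN.
set (a := fun k => INR (fact N) / INR (fact (N + k))).
assert (Hf : forall k, 0 < INR (fact k)) by (intros; apply INR_fact_lt_0).
assert (a0 : a 0%nat = 1).
{ unfold a; rewrite Nat.add_0_r; field; specialize (Hf N); lra. }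
assert (a1 : forall k, Rabs (a k) <= 1).
{ intros k; unfold a; rewrite Rabs_pos_eq.
  - apply Rle_div_l; [apply Hf|].
    rewrite Rmult_1_l; apply le_INR, fact_le; lia.
  - apply Rlt_le, Rdiv_lt_0_compat; apply Hf. }
exists (fun m => INR (fact m) * ps_inv a m), (/ 2); split; [lra|].
intros w [Hw0 Hw].
destruct (ps_inv_series a a0 a1 w Hw) as [Hs Hn].
assert (Hw1 : w <> 0) by (intros E; rewrite E, Rabs_R0 in Hw0; lra).
replace ((w ^ N / INR (fact N)) / (exp w - T (N - 1) w))
  with (/ PSeries a w).
- apply is_pseries_ext with (2 := Hs).
  intros m; specialize (Hf m); unfold Rdiv; symmetry; apply Rinv_r_simpl_m; lra.
- assert (E := PSeries_decr_n (fun n => / INR (fact n)) (N - 1) w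
                 (ex_intro _ _ (is_exp_Reals w))).
  rewrite (is_pseries_unique _ _ _ (is_exp_Reals w)) in E.
  replace (S (N - 1)) with N in E by lia.
  rewrite E; unfold T.
  rewrite (sum_eq _ (fun k => w ^ k / INR (fact k)))
    by (intros; unfold Rdiv; ring).
  assert (Ea : PSeries a w = INR (fact N) *
            PSeries (PS_decr_n (fun n => / INR (fact n)) N) w).
  { rewrite <- PSeries_scal; apply PSeries_ext; intros; reflexivity. }
  clear Hs; rewrite Ea; rewrite Ea in Hn.
  specialize (Hf N).
  assert (w ^ N <> 0) by (apply pow_nonzero; exact Hw1).
  assert (PSeries (PS_decr_n (fun n => / INR (fact n)) N) w <> 0)
    by (intros E0; rewrite E0 in Hn; lra).
  set (P := PSeries (PS_decr_n (fun n => / INR (fact n)) N) w) in *.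
  set (q := sum_f_R0 _ _).
  replace (q + w ^ N * P - q) with (w ^ N * P) by ring.
  field; repeat split; auto; lra.
Qed.

(* Main.v *)
Require Import Defs.
From Stdlib Require Import Reals ZArith Lra Lia.
From Coquelicot Require Import Coquelicot.
From mathcomp Require all_boot zify.
Open Scope R_scope.

(** Put [phi(x) = x^N / (N! (e^x - T_{N-1}(x)))] and let [M phi] be its Mellin
    transform.  Then [zeta_N(s) = N! H(s - 1) / ((s - 1) s ... (s + N - 2))] with
    [H = M phi / Gamma], so everything reduces to the fact that [H] is entire with
    [H(-m) = (-1)^m B_{N,m}], and to [B_{N,m} <> 0] for [m < N].

    Write [phi(x) e^x = sum_j d_j x^j] near [0].  Removing the Taylor terms of this
    series one at a time, each contributing [M(x^j e^{-x})(s) = Gamma(s + j)],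
    gives, with [(s)_k = s (s + 1) ... (s + k - 1)],
      [H(s) = sum_{j<k} d_j (s)_j + (s)_k M phi_k (s + k) / Gamma(s + k)]
    on [Re s > -k], where [phi_k] still decays exponentially.  At [s = -m] only a
    finite sum is left, and it is [(-1)^m m!] times the [m]-th Taylor coefficient of
    [e^{-x} (phi(x) e^x) = phi(x)].  This uses that [Gamma] has no zero.

    For the nonvanishing, let [p^e] be the largest prime power dividing [n = N + 1].
    Then [n^L / ((n + 1) ... (n + L))] is divisible by [p] for [0 < L < n], and the
    recurrence for the coefficients gives [n^m B_{N,m} / m! = (-1)^m] modulo [p]. *)

(** A bare monomial has no Mellin transform on the half-line, whereas [x^j e^{-x}] decays and is
    sent to [Gamma (s + j)]; this is why the Taylor series of [phi(x) e^x], and not that of [phi],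
    is stripped. After division by [Gamma s] each stripped term is the polynomial [(s)_j]. [Gamma]
    is Euler's integral on [0 < Re s], so the remainder and its denominator are both moved to
    [s + k] before the division, and a zero-free [Gamma] makes that quotient analytic. A simple pole
    must have a nonzero residue. The residues are nonzero multiples of [B_{N,m}] with [m < N], and
    this turns part of an analytic statement into an arithmetic one. The number [n = N + 1] and the
    scaling by [n^m] come from the reciprocal of the generating function, whose coefficients are
    [N! / (N + k)!]. Scaled by [n^k] they begin with 1, 1 and go on with
    [n^{k-1} / ((n + 1) ... (n + k - 1))], so that modulo [p] the recurrence keeps two terms. *)

(* [ring] does not see through the coercions from Coquelicot's structures to [C]. *)
Ltac fixC :=
  repeat match goal with
  | z : UniformSpace.sort _ |- _ => change C in (type of z)
  | z : NormedModule.sort _ _ |- _ => change C in (type of z)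
  | z : CompleteNormedModule.sort _ _ |- _ => change C in (type of z)
  end;
  match goal with |- ?a = ?b => change (@eq C a b) end.
Ltac ringC := fixC; ring.
Ltac fieldC := fixC; field.

(** * Complex differentiability *)

Notation locallyC := (@locally C_UniformSpace).
Notation C_derivable := (@ex_derive C_AbsRing C_NormedModule).

(* Coquelicot's [C_NormedModule] is not convertible to the normed module of the
   absolute ring [C], which its product and composition lemmas are about. *)
Lemma is_derive_C_AbsRing (f : C -> C) (z l : C) :
  is_derive (K := C_AbsRing) (V := AbsRing_NormedModule C_AbsRing) f z l <->
  is_derive (K := C_AbsRing) (V := C_NormedModule) f z l.
Proof.
split; intros [[H1 H2 H3] H]; (split; [split; auto|exact H]).
Qed.

Lemma locally_Cmod (a : C) (P : C -> Prop) :
  locally a P <-> exists d : posreal, forall z, Cmod (z - a)%C < d -> P z.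
Proof.
rewrite locally_C; split; intros [d H]; exists d; intros z; apply H.
Qed.

(** The inverse and the Mellin transform are both differentiated through an explicit quadratic
    remainder. *)
Lemma C_derivable_quadratic (f : C -> C) (a D : C) (d K : R) : 0 < d ->
  (forall z, Cmod (z - a)%C < d ->
     Cmod (f z - f a - (z - a) * D)%C <= K * (Cmod (z - a)%C * Cmod (z - a)%C)) ->
  C_derivable f a.
Proof.
intros Hd H; exists D; split.
{ apply (is_linear_scal_l (K := C_AbsRing) (V := C_NormedModule)). }
intros x Hx eps.
assert (E : a = x)
  by (apply (is_filter_lim_locally_unique (K := C_AbsRing)
               (V := AbsRing_NormedModule C_AbsRing) a x Hx)).
subst x; clear Hx.
assert (HK : 0 < Rabs K + 1) by (generalize (Rabs_pos K); lra).
assert (Hd' : 0 < Rmin d (eps / (Rabs K + 1))).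
{ apply Rmin_glb_lt; [exact Hd|].
  apply Rdiv_lt_0_compat; [apply cond_pos|exact HK]. }
exists (mkposreal _ Hd'); intros z Hz.
change (Cmod (z - a)%C < Rmin d (eps / (Rabs K + 1))) in Hz.
change (Cmod (f z - f a - (z - a) * D)%C <= eps * Cmod (z - a)%C).
assert (Hz1 := Rlt_le_trans _ _ _ Hz (Rmin_l _ _)).
assert (Hz2 := Rlt_le_trans _ _ _ Hz (Rmin_r _ _)).
apply Rle_trans with (1 := H z Hz1).
rewrite <- Rmult_assoc; apply Rmult_le_compat_r; [apply Cmod_ge_0|].
apply Rlt_le, Rle_lt_trans with ((Rabs K + 1) * Cmod (z - a)%C).
- apply Rmult_le_compat_r; [apply Cmod_ge_0|].
  generalize (Rle_abs K); lra.
- replace (pos eps) with ((Rabs K + 1) * (eps / (Rabs K + 1))) by (field; lra).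
  apply Rmult_lt_compat_l; assumption.
Qed.

Lemma C_derivable_const (c z : C) : C_derivable (fun _ => c) z.
Proof. apply (ex_derive_const (K := C_AbsRing) (V := C_NormedModule)). Qed.

Lemma C_derivable_id (z : C) : C_derivable (fun w => w) z.
Proof.
exists (RtoC 1); apply is_derive_C_AbsRing.
apply (is_derive_id (K := C_AbsRing)).
Qed.

Lemma C_derivable_plus (f g : C -> C) (z : C) :
  C_derivable f z -> C_derivable g z -> C_derivable (fun w => f w + g w)%C z.
Proof. apply (ex_derive_plus (K := C_AbsRing) (V := C_NormedModule) f g). Qed.

Lemma C_derivable_mult (f g : C -> C) (z : C) :
  C_derivable f z -> C_derivable g z -> C_derivable (fun w => f w * g w)%C z.
Proof.
intros [l Hl] [m Hm].
eexists; apply is_derive_C_AbsRing, (is_derive_mult (K := C_AbsRing) f g).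
- apply is_derive_C_AbsRing, Hl.
- apply is_derive_C_AbsRing, Hm.
- exact Cmult_comm.
Qed.

Lemma C_derivable_comp (f g : C -> C) (z : C) :
  C_derivable f (g z) -> C_derivable g z -> C_derivable (fun w => f (g w)) z.
Proof.
intros [l Hl] [m Hm].
exists (m * l)%C; apply is_derive_C_AbsRing.
apply (is_derive_comp (K := C_AbsRing) (V := AbsRing_NormedModule C_AbsRing) f g).
- apply is_derive_C_AbsRing, Hl.
- apply is_derive_C_AbsRing, Hm.
Qed.

Lemma C_derivable_inv (z : C) : z <> RtoC 0 -> C_derivable Cinv z.
Proof.
intros Hz.
assert (Hm : 0 < Cmod z) by (apply Cmod_gt_0, Hz).
(* The remainder is exactly [(w - z)^2 / (w z^2)], and [|w| >= |z| / 2] on the disc; hence the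
   constant [2 / |z|^3]. *)
apply C_derivable_quadratic with (D := (- / (z * z))%C) (d := Cmod z / 2)
  (K := 2 / (Cmod z * Cmod z * Cmod z)); [lra|].
intros w Hw.
assert (H2 : Cmod z / 2 <= Cmod w).
{ assert (H := Cmod_triangle (z - w) w).
  replace (z - w + w)%C with z in H by ring.
  replace (z - w)%C with (- (w - z))%C in H by ring.
  rewrite Cmod_opp in H; lra. }
assert (Hw0 : w <> RtoC 0) by (apply Cmod_gt_0; lra).
replace (/ w - / z - (w - z) * - / (z * z))%C
  with ((w - z) * (w - z) / (w * (z * z)))%C by (field; auto).
rewrite Cmod_div by (repeat apply Cmult_neq_0; assumption).
rewrite !Cmod_mult; set (h := Cmod (w - z)).
replace (2 / (Cmod z * Cmod z * Cmod z) * (h * h))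
  with (h * h / (Cmod z / 2 * (Cmod z * Cmod z))) by (field; lra).
unfold Rdiv; apply Rmult_le_compat_l; [apply Rmult_le_pos; apply Cmod_ge_0|].
assert (0 < Cmod z * Cmod z) by (apply Rmult_lt_0_compat; lra).
apply Rinv_le_contravar.
- apply Rmult_lt_0_compat; lra.
- apply Rmult_le_compat_r; lra.
Qed.

Lemma analytic_at_ext_loc (f g : C -> C) (a : C) :
  locally a (fun z => f z = g z) -> analytic_at f a -> analytic_at g a.
Proof.
intros E H; unfold analytic_at.
assert (E2 := proj1 (locally_C _ _) (locally_locally _ _ E)).
apply (filter_imp (F := locallyC a)) with (2 := filter_and _ _ (proj2 (locally_C _ _) E2) H).
intros z [H1 H2].
apply (ex_derive_ext_loc (K := C_AbsRing) (V := C_NormedModule) f g);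
  [apply locally_C, H1|exact H2].
Qed.

Lemma analytic_at_const (c a : C) : analytic_at (fun _ => c) a.
Proof. apply (filter_forall (F := locallyC a)); intros z; apply C_derivable_const. Qed.

Lemma analytic_at_id (a : C) : analytic_at (fun z => z) a.
Proof. apply (filter_forall (F := locallyC a)); intros z; apply C_derivable_id. Qed.

Lemma analytic_at_plus (f g : C -> C) (a : C) :
  analytic_at f a -> analytic_at g a -> analytic_at (fun z => f z + g z)%C a.
Proof.
intros Hf Hg; generalize (filter_and (F := locallyC a) _ _ Hf Hg);
apply (filter_imp (F := locallyC a)).
intros z [H1 H2]; apply C_derivable_plus; assumption.
Qed.

Lemma analytic_at_mult (f g : C -> C) (a : C) :
  analytic_at f a -> analytic_at g a -> analytic_at (fun z => f z * g z)%C a.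
Proof.
intros Hf Hg; generalize (filter_and (F := locallyC a) _ _ Hf Hg);
apply (filter_imp (F := locallyC a)).
intros z [H1 H2]; apply C_derivable_mult; assumption.
Qed.

Lemma analytic_at_continuous (f : C -> C) (a : C) :
  analytic_at f a -> filterlim f (locally a) (locally (f a)).
Proof.
intros H; apply locally_singleton in H.
intros P HP; apply locally_C in HP; apply locally_C.
destruct H as [l Hl]; apply is_derive_C_AbsRing in Hl.
apply (ex_derive_continuous (K := C_AbsRing)
  (V := AbsRing_NormedModule C_AbsRing) f a); [exists l; exact Hl|exact HP].
Qed.

Lemma locally_neq_0 (c : C) : c <> RtoC 0 -> locally c (fun z : C => z <> RtoC 0).
Proof.
intros Hc; assert (H : 0 < Cmod c) by (apply Cmod_gt_0, Hc).
apply locally_Cmod; exists (mkposreal _ H); simpl; intros z Hz E; subst z.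
replace (0 - c)%C with (- c)%C in Hz by ring.
rewrite Cmod_opp in Hz; lra.
Qed.

Lemma analytic_at_inv (f : C -> C) (a : C) :
  analytic_at f a -> f a <> RtoC 0 -> analytic_at (fun z => / f z)%C a.
Proof.
intros Hf Ha.
assert (Hn := analytic_at_continuous f a Hf _ (locally_neq_0 _ Ha)).
generalize (filter_and (F := locallyC a) _ _ Hf Hn); apply (filter_imp (F := locallyC a)).
intros z [H1 H2]; apply (C_derivable_comp Cinv f); [|exact H1].
apply C_derivable_inv, H2.
Qed.

Lemma analytic_at_shift (f : C -> C) (a c : C) :
  analytic_at f (a + c) -> analytic_at (fun z => f (z + c)%C) a.
Proof.
intros H; apply locally_Cmod in H; destruct H as [d H].
apply locally_Cmod; exists d; intros z Hz.
apply (C_derivable_comp f (fun z => z + c)%C).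
- apply H; replace (z + c - (a + c))%C with (z - a)%C by ring; exact Hz.
- apply C_derivable_plus; [apply C_derivable_id|apply C_derivable_const].
Qed.

(* That the difference quotient of an analytic function is again analytic would
   need Cauchy's theorem; here it is carried along with the function instead. *)
Definition factorable (f : C -> C) (a : C) : Prop :=
  exists q : C -> C, analytic_at q a /\
    locally a (fun z => f z = f a + (z - a) * q z)%C.

Lemma factorable_analytic (f : C -> C) (a : C) :
  factorable f a -> analytic_at f a.
Proof.
intros [q [Hq E]].
apply analytic_at_ext_loc with (fun z => f a + (z - a) * q z)%C.
- revert E; apply (filter_imp (F := locallyC a)); auto.
- apply analytic_at_plus; [apply analytic_at_const|].
  apply analytic_at_mult; [|exact Hq].
  apply analytic_at_plus; [apply analytic_at_id|apply analytic_at_const].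
Qed.

Lemma factorable_const (c a : C) : factorable (fun _ => c) a.
Proof.
exists (fun _ => RtoC 0); split; [apply analytic_at_const|].
apply (filter_forall (F := locallyC a)); intros z; ringC.
Qed.

Lemma factorable_id (a : C) : factorable (fun z => z) a.
Proof.
exists (fun _ => RtoC 1); split; [apply analytic_at_const|].
apply (filter_forall (F := locallyC a)); intros z; ringC.
Qed.

Lemma factorable_plus (f g : C -> C) (a : C) :
  factorable f a -> factorable g a -> factorable (fun z => f z + g z)%C a.
Proof.
intros [p [Hp Ep]] [q [Hq Eq]].
exists (fun z => p z + q z)%C; split; [apply analytic_at_plus; assumption|].
generalize (filter_and (F := locallyC a) _ _ Ep Eq); apply (filter_imp (F := locallyC a)).
intros z [-> ->]; ringC.
Qed.

Lemma factorable_mult (f g : C -> C) (a : C) :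
  factorable f a -> factorable g a -> factorable (fun z => f z * g z)%C a.
Proof.
intros Hf Hg; assert (Ag := factorable_analytic _ _ Hg).
destruct Hf as [p [Hp Ep]]; destruct Hg as [q [Hq Eq]].
exists (fun z => p z * g z + f a * q z)%C; split.
- apply analytic_at_plus; apply analytic_at_mult; auto using analytic_at_const.
- generalize (filter_and (F := locallyC a) _ _ Ep Eq); apply (filter_imp (F := locallyC a)).
  intros z [-> E]; rewrite E; ringC.
Qed.

Lemma factorable_inv (f : C -> C) (a : C) :
  factorable f a -> f a <> RtoC 0 -> factorable (fun z => / f z)%C a.
Proof.
intros Hf Ha; assert (Af := factorable_analytic _ _ Hf).
assert (Hn := analytic_at_continuous f a Af _ (locally_neq_0 _ Ha)).
destruct Hf as [p [Hp Ep]].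
exists (fun z => - / f a * (p z * / f z))%C; split.
- apply analytic_at_mult; [apply analytic_at_const|].
  apply analytic_at_mult; [exact Hp|apply analytic_at_inv; assumption].
- generalize (filter_and (F := locallyC a) _ _ Ep Hn); apply (filter_imp (F := locallyC a)).
  intros z [E Hz].
  transitivity (/ f a + (f a - f z) * (/ f a * / f z))%C; [fieldC; auto|].
  replace (f a - f z)%C with (- ((z - a) * p z))%C by (rewrite E; ringC).
  ringC.
Qed.

(** * Integrals over the positive half-line *)

Notation is_int0R f l :=
  (is_RInt_gen (V := R_NormedModule) f (at_right 0) (Rbar_locally p_infty) l).
Notation is_int0 f l :=
  (is_RInt_gen (V := C_R_NormedModule) f (at_right 0) (Rbar_locally p_infty) l).

(** Restricting to [0 < a < 1 < b] orients the interval, which removes [Rmin] and [Rmax] from every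
    later use. *)
Lemma filter_prod_pos (P : R * R -> Prop) :
  (forall a b, 0 < a -> a < 1 -> 1 < b -> P (a, b)) ->
  filter_prod (at_right 0) (Rbar_locally p_infty) P.
Proof.
intros H; exists (fun a => 0 < a < 1) (fun b => 1 < b).
- exists (mkposreal 1 Rlt_0_1); intros y Hy Hy0.
  change (Rabs (y - 0) < 1) in Hy; apply Rabs_def2 in Hy; lra.
- exists 1; auto.
- intros a b [Ha1 Ha2] Hb; apply H; assumption.
Qed.

Lemma is_int0_ext (V : NormedModule R_AbsRing) (f g : R -> V) (l : V) :
  (forall x, 0 < x -> f x = g x) ->
  is_RInt_gen f (at_right 0) (Rbar_locally p_infty) l ->
  is_RInt_gen g (at_right 0) (Rbar_locally p_infty) l.
Proof.
intros E; apply is_RInt_gen_ext; try typeclasses eauto.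
apply filter_prod_pos; intros a b Ha Ha1 Hb x; simpl; intros Hx.
apply E; rewrite Rmin_left in Hx; lra.
Qed.

Lemma is_int0_pair (f : R -> C) (l : C) :
  is_int0R (fun x => Re (f x)) (Re l) -> is_int0R (fun x => Im (f x)) (Im l) ->
  is_int0 f l.
Proof.
intros H1 H2.
apply filterlimi_locally; intros eps.
generalize (filter_and _ _ (proj1 (filterlimi_locally _ _) H1 eps)
  (proj1 (filterlimi_locally _ _) H2 eps)).
apply filter_imp; intros [a b] [[x [Hx Bx]] [y [Hy By]]].
exists (x, y); split; [|split; assumption].
apply (is_RInt_fct_extend_pair (U := R_NormedModule) (V := R_NormedModule)); assumption.
Qed.

Lemma is_int0_fst (f : R -> C) (l : C) :
  is_int0 f l -> is_int0R (fun x => Re (f x)) (Re l).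
Proof.
intros H1; apply filterlimi_locally; intros eps.
generalize (proj1 (filterlimi_locally _ _) H1 eps).
apply filter_imp; intros [a b] [x [Hx [B1 B2]]].
exists (fst x); split; [|exact B1].
apply (is_RInt_fct_extend_fst (U := R_NormedModule) (V := R_NormedModule)); assumption.
Qed.

Lemma is_int0_snd (f : R -> C) (l : C) :
  is_int0 f l -> is_int0R (fun x => Im (f x)) (Im l).
Proof.
intros H1; apply filterlimi_locally; intros eps.
generalize (proj1 (filterlimi_locally _ _) H1 eps).
apply filter_imp; intros [a b] [x [Hx [B1 B2]]].
exists (snd x); split; [|exact B2].
apply (is_RInt_fct_extend_snd (U := R_NormedModule) (V := R_NormedModule)); assumption.
Qed.

Lemma is_int0_unique (f : R -> C) (l : C) : is_int0 f l -> CInt_0_infty f = l.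
Proof.
apply (is_RInt_gen_unique (V := C_R_CompleteNormedModule)).
Qed.

Lemma is_int0_plus (f g : R -> C) (l m : C) :
  is_int0 f l -> is_int0 g m -> is_int0 (fun x => f x + g x)%C (l + m)%C.
Proof. apply (is_RInt_gen_plus (V := C_R_NormedModule)). Qed.

(** The integral is taken in [C] as a real vector space, so a complex factor has to go through real
    and imaginary parts. *)
Lemma is_int0_Cmult (f : R -> C) (c l : C) :
  is_int0 f l -> is_int0 (fun x => c * f x)%C (c * l)%C.
Proof.
intros H; assert (H1 := is_int0_fst _ _ H); assert (H2 := is_int0_snd _ _ H).
apply is_int0_pair.
- apply (is_RInt_gen_minus (V := R_NormedModule)
    (fun x => Re c * Re (f x)) (fun x => Im c * Im (f x)));
  apply (is_RInt_gen_scal (V := R_NormedModule)); assumption.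
- apply (is_RInt_gen_plus (V := R_NormedModule)
    (fun x => Re c * Im (f x)) (fun x => Im c * Re (f x)));
  apply (is_RInt_gen_scal (V := R_NormedModule)); assumption.
Qed.

Lemma is_int0R_derive (G g : R -> R) (l m : R) :
  (forall x, 0 < x -> is_derive G x (g x)) ->
  (forall x, 0 < x -> continuous g x) ->
  filterlim G (at_right 0) (locally l) ->
  filterlim G (Rbar_locally p_infty) (locally m) ->
  is_int0R g (m - l).
Proof.
intros HG Hg H0 Hoo.
apply (filterlimi_lim_ext_loc (fun ab => G (snd ab) - G (fst ab))).
- apply filter_prod_pos; simpl; intros a b Ha Ha1 Hb.
  apply (is_RInt_derive (V := R_CompleteNormedModule));
  intros x; rewrite Rmin_left by lra; intros Hx; [apply HG|apply Hg]; lra.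
- apply (filterlim_comp_2 (G := locally m) (H := locally l)
    (fun ab => G (snd ab)) (fun ab => G (fst ab)) Rminus).
  + apply filterlim_comp with (2 := Hoo), filterlim_snd.
  + apply filterlim_comp with (2 := H0), filterlim_fst.
  + apply (filterlim_comp_2 (G := locally m) (H := locally (- l))
      fst (fun z => - snd z) Rplus).
    * apply filterlim_fst.
    * apply filterlim_comp with (1 := filterlim_snd).
      apply (filterlim_opp (V := R_NormedModule)).
    * apply (filterlim_plus (V := R_NormedModule)).
Qed.

(* The substitution [x = exp u] makes this the density [1 / (1 + u ^ 2)]. *)
Definition dom_kernel (x : R) : R := / (x * (1 + ln x * ln x)).

Lemma dom_kernel_den (x : R) : 0 < x -> 0 < x * (1 + ln x * ln x).
Proof. intros Hx; apply Rmult_lt_0_compat; [exact Hx|nra]. Qed.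

Lemma is_derive_atan_ln (x : R) : 0 < x -> is_derive (fun y => atan (ln y)) x (dom_kernel x).
Proof.
intros Hx; assert (H := dom_kernel_den x Hx); unfold dom_kernel.
auto_derive; [exact Hx|unfold Rsqr; field; repeat split; nra].
Qed.

Lemma continuous_dom_kernel (x : R) : 0 < x -> continuous dom_kernel x.
Proof.
intros Hx; assert (H := dom_kernel_den x Hx); unfold dom_kernel.
apply (ex_derive_continuous (K := R_AbsRing) (V := R_NormedModule)).
auto_derive; repeat split; lra.
Qed.

(** The order of [a] and [b] is left open, because the Cauchy criterion compares two lower bounds,
    or two upper bounds, in unknown order. *)
Lemma norm_is_RInt_le_kernel (V : CompleteNormedModule R_AbsRing) (g : R -> V) (M a b : R) (l : V) :
  0 < a -> 0 < b ->
  (forall x, 0 < x -> norm (g x) <= M * dom_kernel x) ->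
  is_RInt g a b l ->
  norm l <= Rabs (M * atan (ln b) - M * atan (ln a)).
Proof.
intros Ha Hb Hg Hl.
assert (Hk : forall x y, 0 < x -> x <= y ->
  is_RInt (fun t => M * dom_kernel t) x y (M * atan (ln y) - M * atan (ln x))).
{ intros x y Hx Hxy.
  apply (is_RInt_derive (V := R_CompleteNormedModule) (fun t => M * atan (ln t)));
  intros t; rewrite Rmin_left by lra; intros Ht.
  - apply (is_derive_scal (fun t => atan (ln t))); apply is_derive_atan_ln; lra.
  - apply (continuous_scal_r (V := R_NormedModule)); apply continuous_dom_kernel; lra. }
destruct (Rle_lt_dec a b) as [Hab|Hab].
- apply Rle_trans with (2 := Rle_abs _).
  apply (norm_RInt_le g (fun t => M * dom_kernel t) a b); auto.
  intros x Hx; apply Hg; lra.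
- rewrite <- Rabs_Ropp; apply Rle_trans with (2 := Rle_abs _).
  rewrite <- norm_opp, Ropp_minus_distr.
  apply (norm_RInt_le g (fun t => M * dom_kernel t) b a); auto; try lra.
  + intros x Hx; apply Hg; lra.
  + apply is_RInt_swap, Hl.
  + apply Hk; lra.
Qed.

Lemma filterlim_atan_p_infty : filterlim atan (Rbar_locally p_infty) (locally (PI / 2)).
Proof.
apply filterlim_locally; intros eps.
assert (Hp := PI_RGT_0).
assert (He : 0 < Rmin eps (PI / 2)) by (apply Rmin_glb_lt; [apply cond_pos|lra]).
assert (H1 := Rmin_l eps (PI / 2)); assert (H2 := Rmin_r eps (PI / 2)).
set (e := Rmin eps (PI / 2)) in *.
exists (tan (PI / 2 - e / 2)); intros x Hx.
apply atan_increasing in Hx; rewrite atan_tan in Hx by lra.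
change (Rabs (atan x - PI / 2) < eps).
assert (Hb := atan_bound x); apply Rabs_def1; lra.
Qed.

Lemma filterlim_atan_m_infty : filterlim atan (Rbar_locally m_infty) (locally (- (PI / 2))).
Proof.
apply (filterlim_ext (fun x => - atan (- x))).
{ intros x; rewrite atan_opp; ring. }
apply filterlim_comp with (locally (PI / 2)).
- apply filterlim_comp with (Rbar_locally p_infty).
  + apply (filterlim_Rbar_opp m_infty).
  + apply filterlim_atan_p_infty.
- apply (filterlim_opp (V := R_NormedModule)).
Qed.

Lemma is_int0R_kernel (M : R) : is_int0R (fun x => M * dom_kernel x) (M * PI).
Proof.
replace (M * PI) with (scal M (PI / 2 - - (PI / 2)))
  by (unfold scal; simpl; unfold mult; simpl; field).
apply (is_RInt_gen_scal (V := R_NormedModule)).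
apply is_int0R_derive with (fun x => atan (ln x)).
- apply is_derive_atan_ln.
- apply continuous_dom_kernel.
- apply filterlim_comp with (1 := is_lim_ln_0), filterlim_atan_m_infty.
- apply filterlim_comp with (Rbar_locally p_infty); [|apply filterlim_atan_p_infty].
  apply is_lim_ln_p.
Qed.

Lemma plus_minus_middle (G : AbelianGroup) (x y z : G) :
  plus x z = minus (plus (plus x y) z) y.
Proof.
unfold minus; rewrite <- !plus_assoc; f_equal.
rewrite (plus_comm z), plus_assoc; symmetry.
apply eq_trans with (plus zero z); [f_equal; apply plus_opp_r|apply plus_zero_l].
Qed.

(** The primitive [atan (ln x)] of the kernel has finite limits at both ends, which gives the Cauchy
    criterion; the total mass [PI] gives the norm bound. This is the only source of convergence for
    the Mellin integrals. *)
Lemma ex_int0_dominated (V : CompleteNormedModule R_AbsRing) (g : R -> V) (M : R) :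
  (forall x, 0 < x -> continuous g x) ->
  (forall x, 0 < x -> norm (g x) <= M * dom_kernel x) ->
  exists l, is_RInt_gen g (at_right 0) (Rbar_locally p_infty) l /\ norm l <= M * PI.
Proof.
intros Hc Hg.
assert (Hex : forall a b, 0 < a -> 0 < b -> ex_RInt g a b).
{ intros a b Ha Hb; apply (ex_RInt_continuous (V := V)); intros z Hz; apply Hc.
  assert (H := Rmin_glb_lt _ _ _ Ha Hb); lra. }
assert (HL : exists l, is_RInt_gen g (at_right 0) (Rbar_locally p_infty) l).
{ apply (filterlimi_locally_cauchy (U := V)
    (F := filter_prod (at_right 0) (Rbar_locally p_infty))
    (fun ab => is_RInt g (fst ab) (snd ab))).
  - apply filter_prod_pos; simpl; intros a b Ha Ha1 Hb; split.
    + apply Hex; lra.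
    + intros y1 y2 H1 H2; rewrite <- (is_RInt_unique _ _ _ _ H1); apply is_RInt_unique, H2.
  - intros eps.
    assert (He : 0 < eps / 4) by (generalize (cond_pos eps); lra).
    assert (L0 : filterlim (fun x => M * atan (ln x)) (at_right 0) (locally (scal M (- (PI / 2))))).
    { apply filterlim_comp with (locally (- (PI / 2))).
      - apply filterlim_comp with (1 := is_lim_ln_0), filterlim_atan_m_infty.
      - apply (filterlim_scal_r (V := R_NormedModule)). }
    assert (Loo : filterlim (fun x => M * atan (ln x)) (Rbar_locally p_infty) (locally (scal M (PI / 2)))).
    { apply filterlim_comp with (locally (PI / 2)).
      - apply filterlim_comp with (2 := filterlim_atan_p_infty), is_lim_ln_p.
      - apply (filterlim_scal_r (V := R_NormedModule)). }
    assert (P0 := proj1 (filterlim_locally _ _) L0 (mkposreal _ He)).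
    assert (Poo := proj1 (filterlim_locally _ _) Loo (mkposreal _ He)).
    (* Two points within [eps / 4] of the same limit differ by less than [eps / 2], and there are
       two ends. *)
    exists (fun ab => (0 < fst ab /\ Rabs (M * atan (ln (fst ab)) - M * (- (PI / 2))) < eps / 4)
      /\ (0 < snd ab /\ Rabs (M * atan (ln (snd ab)) - M * (PI / 2)) < eps / 4)); split.
    + exists (fun a => 0 < a /\ Rabs (M * atan (ln a) - M * (- (PI / 2))) < eps / 4)
        (fun b => 0 < b /\ Rabs (M * atan (ln b) - M * (PI / 2)) < eps / 4);
        [| |intros a b HA HB; exact (conj HA HB)].
      * apply filter_and; [|exact P0].
        exists (mkposreal 1 Rlt_0_1); intros y _ Hy; exact Hy.
      * apply filter_and; [|exact Poo].
        exists 0; auto.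
    + intros [a b] [a' b']; simpl.
      intros [[Ha Ka] [Hb Kb]] [[Ha' Ka'] [Hb' Kb']] l l' Hl Hl'.
      apply (norm_compat1 (V := V)).
      destruct (Hex a' a Ha' Ha) as [m1 H1]; destruct (Hex b b' Hb Hb') as [m2 H2].
      assert (E : l' = plus (plus m1 l) m2).
      { rewrite <- (is_RInt_unique _ _ _ _ Hl'); apply is_RInt_unique.
        apply is_RInt_Chasles with b; [|exact H2].
        apply is_RInt_Chasles with a; assumption. }
      assert (N1 := norm_is_RInt_le_kernel V g M a' a m1 Ha' Ha Hg H1).
      assert (N2 := norm_is_RInt_le_kernel V g M b b' m2 Hb Hb' Hg H2).
      assert (E' : plus m1 m2 = minus l' l) by (rewrite E; apply (plus_minus_middle V)).
      apply Rle_lt_trans with (norm (plus m1 m2)); [right; f_equal; symmetry; exact E'|].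
      apply Rle_lt_trans with (1 := norm_triangle _ _).
      assert (Rabs (M * atan (ln a) - M * atan (ln a')) < eps / 2).
      { apply Rabs_def2 in Ka; apply Rabs_def2 in Ka'; apply Rabs_def1; lra. }
      assert (Rabs (M * atan (ln b') - M * atan (ln b)) < eps / 2).
      { apply Rabs_def2 in Kb; apply Rabs_def2 in Kb'; apply Rabs_def1; lra. }
      apply Rle_lt_trans with (1 := Rplus_le_compat _ _ _ _ N1 N2); lra. }
destruct HL as [l Hl]; exists l; split; [exact Hl|].
apply (RInt_gen_norm (V := V) (Fa := at_right 0) (Fb := Rbar_locally p_infty) g (fun x => M * dom_kernel x)).
- apply filter_prod_pos; simpl; intros; lra.
- apply filter_prod_pos; simpl; intros a b Ha Ha1 Hb x Hx; apply Hg; lra.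
- exact Hl.
- apply is_int0R_kernel.
Qed.

(** * Mellin transforms *)

Lemma Cmod_Rcpow (x : R) (s : C) : Cmod (Rcpow x s) = exp (Re s * ln x).
Proof.
unfold Cmod, Rcpow; simpl fst; simpl snd.
set (e := exp _); set (t := Im s * ln x).
replace ((e * cos t) ^ 2 + (e * sin t) ^ 2) with (e ^ 2).
- apply sqrt_pow2, Rlt_le, exp_pos.
- generalize (sin2_cos2 t); unfold Rsqr; intros H.
  transitivity (e ^ 2 * (sin t * sin t + cos t * cos t)); [rewrite H|]; ring.
Qed.

Lemma Rcpow_plus (x : R) (s t : C) : Rcpow x (s + t) = (Rcpow x s * Rcpow x t)%C.
Proof.
unfold Rcpow; simpl.
rewrite !Rmult_plus_distr_r, exp_plus, cos_plus, sin_plus.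
apply injective_projections; unfold Re, Im; simpl; ring.
Qed.

Lemma Rcpow_RtoC (x r : R) : Rcpow x (RtoC r) = RtoC (exp (r * ln x)).
Proof.
unfold Rcpow, RtoC; simpl; rewrite Rmult_0_l, cos_0, sin_0; f_equal; ring.
Qed.

Lemma exp_INR_ln (x : R) (n : nat) : 0 < x -> exp (INR n * ln x) = x ^ n.
Proof. intros Hx; rewrite <- (Rpower_pow n x Hx); reflexivity. Qed.

Lemma continuous_C_pair (f : R -> C) (x : R) :
  continuous (fun y => Re (f y)) x -> continuous (fun y => Im (f y)) x ->
  continuous (U := C_R_CompleteNormedModule) f x.
Proof.
intros H1 H2.
apply filterlim_locally; intros eps.
generalize (filter_and _ _ (proj1 (filterlim_locally _ _) H1 eps)
  (proj1 (filterlim_locally _ _) H2 eps)).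
apply (filter_imp (F := locally x)); intros y [B1 B2]; split; assumption.
Qed.

Lemma continuous_Re (f : R -> C) (x : R) :
  continuous (U := C_R_CompleteNormedModule) f x -> continuous (fun y => Re (f y)) x.
Proof.
intros H; apply filterlim_locally; intros eps.
generalize (proj1 (filterlim_locally _ _) H eps).
apply (filter_imp (F := locally x)); intros y [B1 B2]; assumption.
Qed.

Lemma continuous_Im (f : R -> C) (x : R) :
  continuous (U := C_R_CompleteNormedModule) f x -> continuous (fun y => Im (f y)) x.
Proof.
intros H; apply filterlim_locally; intros eps.
generalize (proj1 (filterlim_locally _ _) H eps).
apply (filter_imp (F := locally x)); intros y [B1 B2]; assumption.
Qed.

Lemma continuous_Cmult (f g : R -> C) (x : R) :
  continuous (U := C_R_CompleteNormedModule) f x ->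
  continuous (U := C_R_CompleteNormedModule) g x ->
  continuous (U := C_R_CompleteNormedModule) (fun y => f y * g y)%C x.
Proof.
intros Hf Hg.
assert (F1 := continuous_Re _ _ Hf); assert (F2 := continuous_Im _ _ Hf).
assert (G1 := continuous_Re _ _ Hg); assert (G2 := continuous_Im _ _ Hg).
apply continuous_C_pair; simpl.
- apply (continuous_minus (V := R_NormedModule));
  apply (continuous_mult (K := R_AbsRing)); assumption.
- apply (continuous_plus (V := R_NormedModule));
  apply (continuous_mult (K := R_AbsRing)); assumption.
Qed.

Lemma continuous_RtoC (f : R -> R) (x : R) :
  continuous f x -> continuous (U := C_R_CompleteNormedModule) (fun y => RtoC (f y)) x.
Proof.
intros Hf; apply continuous_C_pair; simpl; [exact Hf|apply continuous_const].
Qed.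

Lemma continuous_Rcpow (s : C) (x : R) : 0 < x ->
  continuous (U := C_R_CompleteNormedModule) (fun y => Rcpow y s) x.
Proof.
intros Hx; apply continuous_C_pair; unfold Rcpow; simpl;
apply (ex_derive_continuous (K := R_AbsRing) (V := R_NormedModule));
auto_derive; auto.
Qed.

(** The exponent is concave in [u] with its maximum at [u = ln (2 * a)]; the tangent line of [exp]
    at that point gives the bound. *)
Lemma exp_linear_minus_exp_bounded (a : R) : 0 < a ->
  forall u, exp (a * u - exp u / 2) <= exp (a * ln (2 * a) - a).
Proof.
intros Ha u.
assert (H : 2 * a * (1 + (u - ln (2 * a))) <= exp u).
{ replace (exp u) with (2 * a * exp (u - ln (2 * a))).
  - apply Rmult_le_compat_l; [lra|]; apply exp_ineq1_le.
  - unfold Rminus; rewrite exp_plus, exp_Ropp, exp_ln by lra; field; lra. }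
destruct (Rle_lt_or_eq_dec (a * u - exp u / 2) (a * ln (2 * a) - a)) as [H1|H1]; [nra| |].
- apply Rlt_le, exp_increasing, H1.
- rewrite H1; lra.
Qed.

Lemma quartic_le_exp (c : R) : 0 < c ->
  exists K, 0 < K /\ forall u, (1 + u * u) * (1 + u * u) <= K * exp (c * Rabs u).
Proof.
(* With this [m], [m * (1 + |u|) <= 1 + c / 4 * |u| <= exp (c / 4 * |u|)]; the fourth power of this
   is the claim. *)
intros Hc; set (m := Rmin 1 (c / 4)).
assert (Hm : 0 < m) by (apply Rmin_glb_lt; lra).
exists (/ (m ^ 4)); split; [apply Rinv_0_lt_compat, pow_lt, Hm|].
intros u; assert (Hu := Rabs_pos u).
assert (H : m * (1 + Rabs u) <= exp (c / 4 * Rabs u)).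
{ apply Rle_trans with (2 := exp_ineq1_le _).
  assert (H1 := Rmin_l 1 (c / 4)); assert (H2 := Rmin_r 1 (c / 4)); fold m in H1, H2; nra. }
replace (c * Rabs u) with (INR 4 * (c / 4 * Rabs u)) by (simpl; field).
replace (exp (INR 4 * (c / 4 * Rabs u))) with (exp (c / 4 * Rabs u) ^ 4).
2:{ rewrite <- Rpower_pow by apply exp_pos; unfold Rpower; rewrite ln_exp; reflexivity. }
apply Rmult_le_reg_l with (m ^ 4); [apply pow_lt, Hm|].
apply Rle_trans with ((m * (1 + Rabs u)) ^ 4).
- rewrite Rpow_mult_distr; apply Rmult_le_compat_l; [apply pow_le; lra|].
  replace (u * u) with (Rabs u * Rabs u) by (rewrite <- Rabs_mult, Rabs_pos_eq; [ring|nra]).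
  set (v := Rabs u) in *.
  replace ((1 + v) ^ 4) with (((1 + v) * (1 + v)) * ((1 + v) * (1 + v))) by ring.
  apply Rmult_le_compat; nra.
- rewrite <- Rmult_assoc, Rinv_r, Rmult_1_l by (apply pow_nonzero; lra).
  apply pow_incr; split; [nra|exact H].
Qed.

(** In the variable [u = ln x], the factor [exp (c * u - exp u / 2)] is [x^c e^{-x/2}]. One factor
    [1 + u * u] pays for [dom_kernel]; the other one and [exp (c / 2 * |u|)] leave room for the
    weights used in differentiation. For [u < 0] the growth is compensated by [exp (c * u)], for
    [u >= 0] by the double exponential. *)
Lemma mellin_kernel_bound (c : R) : 0 < c ->
  exists K, 0 < K /\ forall u,
    (1 + u * u) * (1 + u * u) * exp (c * u - exp u / 2) * exp (c / 2 * Rabs u) <= K.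
Proof.
intros Hc.
destruct (quartic_le_exp (c / 2)) as [K [HK H]]; [lra|].
set (L := exp (2 * c * ln (2 * (2 * c)) - 2 * c)).
exists (K * Rmax 1 L); split.
{ apply Rmult_lt_0_compat; [exact HK|].
  apply Rlt_le_trans with 1; [lra|apply Rmax_l]. }
intros u; rewrite Rmult_assoc.
apply Rle_trans with (K * exp (c / 2 * Rabs u) *
  (exp (c * u - exp u / 2) * exp (c / 2 * Rabs u))).
{ apply Rmult_le_compat_r; [|apply H].
  apply Rmult_le_pos; apply Rlt_le, exp_pos. }
rewrite Rmult_assoc; apply Rmult_le_compat_l; [lra|].
rewrite <- !exp_plus.
destruct (Rle_lt_dec 0 u) as [Hu|Hu].
- apply Rle_trans with (2 := Rmax_r _ _); rewrite Rabs_pos_eq by exact Hu.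
  replace (c / 2 * u + (c * u - exp u / 2 + c / 2 * u)) with (2 * c * u - exp u / 2) by field.
  apply exp_linear_minus_exp_bounded; lra.
- apply Rle_trans with (2 := Rmax_l _ _); rewrite Rabs_left by exact Hu.
  rewrite <- exp_0; apply Rlt_le, exp_increasing.
  generalize (exp_pos u); intros; nra.
Qed.

(** The rate 1/2 in place of 1 absorbs the factor [x^N] of the generating function. The bound also
    holds near 0, so that [0 < Re s] suffices for convergence there. *)
Definition exp_decay (f : R -> R) : Prop :=
  (forall x, 0 < x -> continuous f x) /\
  exists K, 0 < K /\ forall x, 0 < x -> Rabs (f x) <= K * exp (- x / 2).

Definition Mellin (f : R -> R) (s : C) : C :=
  CInt_0_infty (fun x => Rcpow x (s - 1) * RtoC (f x))%C.

Lemma ex_int0_mellin (f : R -> R) (s : C) : exp_decay f -> 0 < Re s ->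
  exists K, 0 < K /\ forall (h : R -> C) (M : R),
    (forall x, 0 < x -> continuous (U := C_R_CompleteNormedModule) h x) ->
    (forall x, 0 < x -> Cmod (h x) <=
       M * ((1 + ln x * ln x) * exp (Re s / 2 * Rabs (ln x)))) ->
    exists l, is_int0 (fun x => Rcpow x (s - 1) * (h x * RtoC (f x)))%C l /\ Cmod l <= M * K.
Proof.
intros [Hc [Kf [HKf Hf]]] Hs.
destruct (mellin_kernel_bound (Re s) Hs) as [K [HK HB]].
exists (Kf * K * PI); split.
{ apply Rmult_lt_0_compat; [nra|apply PI_RGT_0]. }
intros h M Hh Hhb.
assert (HM : 0 <= M).
{ assert (H := Hhb 1 Rlt_0_1); rewrite ln_1, Rabs_R0, !Rmult_0_r, Rplus_0_r, exp_0 in H.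
  generalize (Cmod_ge_0 (h 1)); lra. }
destruct (ex_int0_dominated C_R_CompleteNormedModule
  (fun x => Rcpow x (s - 1) * (h x * RtoC (f x)))%C (M * (Kf * K))) as [l [Hl Hn]].
- intros x Hx; apply continuous_Cmult; [apply continuous_Rcpow, Hx|].
  apply continuous_Cmult; [apply Hh, Hx|apply continuous_RtoC, Hc, Hx].
- intros x Hx; rewrite <- Cmod_norm, !Cmod_mult, Cmod_Rcpow, Cmod_R.
  assert (Hd := dom_kernel_den x Hx).
  specialize (HB (ln x)); specialize (Hhb x Hx); specialize (Hf x Hx).
  rewrite exp_ln in HB by exact Hx.
  unfold dom_kernel.
  apply Rmult_le_reg_r with (1 := Hd).
  rewrite (Rmult_assoc (M * _)), Rinv_l, Rmult_1_r by lra.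
  replace (exp (Re (s - 1) * ln x)) with (exp (Re s * ln x) / x).
  2:{ replace (Re (s - 1) * ln x) with (Re s * ln x + - ln x) by (unfold Re; simpl; ring).
      rewrite exp_plus, exp_Ropp, exp_ln by exact Hx; reflexivity. }
  replace (Re s * ln x - x / 2) with (Re s * ln x + - x / 2) in HB by field.
  rewrite exp_plus in HB.
  set (u := ln x) in *; set (A := exp (Re s * u)) in *; set (E := exp (- x / 2)) in *.
  set (W := exp (Re s / 2 * Rabs u)) in *.
  replace (A / x * (Cmod (h x) * Rabs (f x)) * (x * (1 + u * u)))
    with (A * (1 + u * u) * (Cmod (h x) * Rabs (f x))) by (field; lra).
  assert (HA : 0 < A) by apply exp_pos.
  apply Rle_trans with (A * (1 + u * u) * ((M * ((1 + u * u) * W)) * (Kf * E))).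
  + apply Rmult_le_compat_l; [apply Rmult_le_pos; nra|].
    apply Rmult_le_compat; auto using Cmod_ge_0, Rabs_pos.
  + replace (A * (1 + u * u) * (M * ((1 + u * u) * W) * (Kf * E)))
      with (M * Kf * ((1 + u * u) * (1 + u * u) * (A * E) * W)) by ring.
    rewrite <- (Rmult_assoc M); apply Rmult_le_compat_l; [nra|exact HB].
- exists l; split; [exact Hl|].
  rewrite Cmod_norm; apply Rle_trans with (1 := Hn); right; ring.
Qed.

Lemma is_int0_Mellin (f : R -> R) (s : C) : exp_decay f -> 0 < Re s ->
  is_int0 (fun x => Rcpow x (s - 1) * RtoC (f x))%C (Mellin f s).
Proof.
intros Hf Hs; destruct (ex_int0_mellin f s Hf Hs) as [K [HK H]].
destruct (H (fun _ => RtoC 1) 1) as [l [Hl _]].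
- intros x _; apply continuous_const.
- intros x _; rewrite Cmod_1, Rmult_1_l.
  assert (1 <= exp (Re s / 2 * Rabs (ln x))).
  { apply Rle_trans with (2 := exp_ineq1_le _).
    generalize (Rabs_pos (ln x)); nra. }
  nra.
- assert (E : is_int0 (fun x => Rcpow x (s - 1) * RtoC (f x))%C l).
  { revert Hl; apply is_int0_ext; intros x _; ringC. }
  unfold Mellin; rewrite (is_int0_unique _ _ E); exact E.
Qed.

(** * Second-order expansion of [x^t] at [t = 0], and differentiability of the Mellin transform *)

Lemma MVT_bound (f df : R -> R) (M : R) :
  (forall x, is_derive f x (df x)) -> forall b,
  (forall x, Rabs x <= Rabs b -> Rabs (df x) <= M) ->
  Rabs (f b - f 0) <= M * Rabs b.
Proof.
intros Hf b Hb.
destruct (MVT_gen f 0 b df) as [c [Hc E]].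
- intros x _; apply Hf.
- intros x _; apply derivable_continuous_pt; exists (df x); apply is_derive_Reals, Hf.
- rewrite E, Rabs_mult, Rminus_0_r; apply Rmult_le_compat_r; [apply Rabs_pos|].
  apply Hb; revert Hc; unfold Rmin, Rmax; destruct (Rle_dec 0 b); intros Hc.
  + rewrite !Rabs_pos_eq; lra.
  + destruct (Req_dec c 0) as [->|Hn]; [rewrite Rabs_R0; apply Rabs_pos|].
    rewrite !Rabs_left; lra.
Qed.

Lemma exp_sub1_bound (a : R) : Rabs (exp a - 1) <= Rabs a * exp (Rabs a).
Proof.
rewrite <- exp_0 at 1; rewrite Rmult_comm.
apply (MVT_bound exp exp (exp (Rabs a))).
- intros x; apply is_derive_Reals, derivable_pt_lim_exp.
- intros x Hx; rewrite Rabs_pos_eq by apply Rlt_le, exp_pos.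
  destruct (Rle_lt_or_eq_dec x (Rabs a)) as [H|H].
  + apply Rle_trans with (2 := Hx), Rle_abs.
  + apply Rlt_le, exp_increasing, H.
  + rewrite H; lra.
Qed.

Lemma exp_sub1_sub_bound (a : R) : Rabs (exp a - 1 - a) <= a * a * exp (Rabs a).
Proof.
replace (exp a - 1 - a) with ((exp a - a) - (exp 0 - 0)) by (rewrite exp_0; ring).
apply Rle_trans with (Rabs a * exp (Rabs a) * Rabs a).
- apply (MVT_bound (fun x => exp x - x) (fun x => exp x - 1)).
  + intros x; auto_derive; [exact I|ring].
  + intros x Hx; apply Rle_trans with (1 := exp_sub1_bound x).
    assert (exp (Rabs x) <= exp (Rabs a)).
    { destruct (Rle_lt_or_eq_dec _ _ Hx) as [H|H].
      - apply Rlt_le, exp_increasing, H.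
      - rewrite H; lra. }
    apply Rmult_le_compat; auto using Rabs_pos.
    apply Rlt_le, exp_pos.
- right; rewrite Rmult_assoc, Rmult_comm, Rmult_assoc, (Rmult_comm (exp _)), <- Rabs_mult.
  rewrite (Rabs_pos_eq (a * a)) by nra; ring.
Qed.

Lemma sin_abs_le (b : R) : Rabs (sin b) <= Rabs b.
Proof.
replace (sin b) with (sin b - sin 0) by (rewrite sin_0; ring).
replace (Rabs b) with (1 * Rabs b) by ring.
apply (MVT_bound sin cos).
- intros x; apply is_derive_Reals, derivable_pt_lim_sin.
- intros x _; apply Rabs_le, COS_bound.
Qed.

Lemma cos_sub1_bound (b : R) : Rabs (cos b - 1) <= b * b / 2.
Proof.
replace (cos b) with (cos (2 * (b / 2))) by (f_equal; field).
rewrite cos_2a_sin.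
replace (1 - 2 * sin (b / 2) * sin (b / 2) - 1)
  with (- (2 * (sin (b / 2) * sin (b / 2)))) by ring.
rewrite Rabs_Ropp, Rabs_mult, Rabs_mult, (Rabs_pos_eq 2) by lra.
assert (H := sin_abs_le (b / 2)).
replace (b * b / 2) with (2 * (Rabs (b / 2) * Rabs (b / 2))).
- apply Rmult_le_compat_l; [lra|]; apply Rmult_le_compat; auto using Rabs_pos.
- rewrite <- Rabs_mult, Rabs_pos_eq; [field|nra].
Qed.

Lemma sin_sub_bound (b : R) : Rabs (sin b - b) <= b * b.
Proof.
replace (sin b - b) with ((sin b - b) - (sin 0 - 0)) by (rewrite sin_0; ring).
apply Rle_trans with (Rabs b * Rabs b).
- apply (MVT_bound (fun x => sin x - x) (fun x => cos x - 1)).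
  + intros x; auto_derive; [exact I|ring].
  + intros x Hx; replace (cos x) with (cos (2 * (x / 2))) by (f_equal; field).
    rewrite cos_2a_sin.
    replace (1 - 2 * sin (x / 2) * sin (x / 2) - 1)
      with (- (2 * (sin (x / 2) * sin (x / 2)))) by ring.
    rewrite Rabs_Ropp, Rabs_mult, Rabs_mult, (Rabs_pos_eq 2) by lra.
    apply Rle_trans with (2 * (Rabs (x / 2) * 1)).
    * apply Rmult_le_compat_l; [lra|]; apply Rmult_le_compat; auto using Rabs_pos, sin_abs_le.
      apply Rabs_le, SIN_bound.
    * unfold Rdiv; rewrite Rabs_mult, (Rabs_pos_eq (/ 2)) by lra; lra.
- right; rewrite <- Rabs_mult, Rabs_pos_eq; nra.
Qed.

Lemma Cmod_le_abs (z : C) : Cmod z <= Rabs (Re z) + Rabs (Im z).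
Proof.
apply Rle_trans with (Cmod (RtoC (Re z)) + Cmod (RtoC (Im z) * Ci)%C).
- replace z with (RtoC (Re z) + RtoC (Im z) * Ci)%C at 1; [apply Cmod_triangle|].
  apply injective_projections; unfold Re, Im; simpl; ring.
- rewrite Cmod_mult, Cmod_Ci, !Cmod_R; lra.
Qed.

(** Write [t * ln x = a + i b]. The remainder has real part [(exp a - 1 - a) + exp a * (cos b - 1)]
    and imaginary part [exp a * (sin b - b) + b * (exp a - 1)]. With [m = |t| * |ln x|] each of
    these four terms is at most [m^2 * exp m], hence the constant 4. *)
Lemma Rcpow_remainder (x : R) (t : C) :
  Cmod (Rcpow x t - 1 - t * RtoC (ln x))%C <=
  4 * (Cmod t * Cmod t) * (ln x * ln x * exp (Cmod t * Rabs (ln x))).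
Proof.
set (u := ln x); set (a := Re t * u); set (b := Im t * u); set (m := Cmod t * Rabs u).
assert (Ha : Rabs a <= m).
{ unfold a, m; rewrite Rabs_mult; apply Rmult_le_compat_r; [apply Rabs_pos|apply re_le_Cmod]. }
assert (Hb : Rabs b <= m).
{ unfold b, m; rewrite Rabs_mult; apply Rmult_le_compat_r; [apply Rabs_pos|].
  apply Rle_trans with (2 := Rmax_Cmod t), Rmax_r. }
assert (Hm : 0 <= m) by (apply Rle_trans with (2 := Ha), Rabs_pos).
assert (Hexp : forall y, y <= m -> exp y <= exp m).
{ intros y Hy; destruct (Rle_lt_or_eq_dec _ _ Hy) as [H| ->]; [|lra].
  apply Rlt_le, exp_increasing, H. }
assert (He1 : 1 <= exp m) by (rewrite <- exp_0; apply Hexp, Hm).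
assert (Hea : exp a <= exp m) by (apply Hexp; apply Rle_trans with (2 := Ha), Rle_abs).
assert (Sq : forall y, Rabs y <= m -> y * y <= m * m).
{ intros y Hy; rewrite <- (Rabs_pos_eq (y * y)) by nra; rewrite Rabs_mult.
  apply Rmult_le_compat; auto using Rabs_pos. }
assert (Haa := Sq a Ha); assert (Hbb := Sq b Hb).
replace (4 * (Cmod t * Cmod t) * (u * u * exp m)) with (4 * (m * m * exp m)).
2:{ unfold m; replace (u * u) with (Rabs u * Rabs u);
    [ring|rewrite <- Rabs_mult, Rabs_pos_eq; nra]. }
apply Rle_trans with (1 := Cmod_le_abs _).
replace (Re (Rcpow x t - 1 - t * RtoC u)%C) with ((exp a - 1 - a) + exp a * (cos b - 1)).
2:{ unfold Rcpow, a, b, u, Re, Im; simpl; ring. }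
replace (Im (Rcpow x t - 1 - t * RtoC u)%C) with (exp a * (sin b - b) + b * (exp a - 1)).
2:{ unfold Rcpow, a, b, u, Re, Im; simpl; ring. }
assert (Hpa := exp_pos a); assert (Hpm := exp_pos m).
assert (E1 : Rabs (exp a - 1 - a) <= m * m * exp m).
{ apply Rle_trans with (1 := exp_sub1_sub_bound a).
  apply Rmult_le_compat; auto; [nra|apply Rlt_le, exp_pos]. }
assert (E2 : Rabs (exp a * (cos b - 1)) <= m * m * exp m).
{ rewrite Rabs_mult, (Rabs_pos_eq (exp a)), Rmult_comm by lra.
  apply Rmult_le_compat; auto using Rabs_pos; [lra|].
  apply Rle_trans with (1 := cos_sub1_bound b); nra. }
assert (E3 : Rabs (exp a * (sin b - b)) <= m * m * exp m).
{ rewrite Rabs_mult, (Rabs_pos_eq (exp a)), Rmult_comm by lra.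
  apply Rmult_le_compat; auto using Rabs_pos; [lra|].
  apply Rle_trans with (1 := sin_sub_bound b); nra. }
assert (E4 : Rabs (b * (exp a - 1)) <= m * m * exp m).
{ rewrite Rabs_mult, (Rmult_assoc m).
  apply Rmult_le_compat; auto using Rabs_pos.
  apply Rle_trans with (1 := exp_sub1_bound a).
  apply Rmult_le_compat; auto using Rabs_pos; apply Rlt_le, exp_pos. }
apply Rle_trans with (1 := Rplus_le_compat _ _ _ _ (Rabs_triang _ _) (Rabs_triang _ _)).
lra.
Qed.

Lemma C_derivable_Mellin (f : R -> R) (s : C) : exp_decay f -> 0 < Re s ->
  C_derivable (Mellin f) s.
Proof.
intros Hf Hs; destruct (ex_int0_mellin f s Hf Hs) as [K [HK H]].
assert (Hw : forall x, 1 <= exp (Re s / 2 * Rabs (ln x))).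
{ intros x; apply Rle_trans with (2 := exp_ineq1_le _).
  generalize (Rabs_pos (ln x)); nra. }
destruct (H (fun x => RtoC (ln x)) 1) as [D [HD _]].
{ intros x Hx; apply continuous_RtoC.
  apply (ex_derive_continuous (K := R_AbsRing) (V := R_NormedModule)); auto_derive; exact Hx. }
{ intros x _; rewrite Cmod_R, Rmult_1_l.
  apply Rle_trans with ((1 + ln x * ln x) * 1).
  - apply Rabs_le; nra.
  - apply Rmult_le_compat_l; [nra|apply Hw]. }
(* The derivative [D] is the Mellin integral with the extra weight [ln x]. On the disc of radius
   [Re s / 2] the factor [exp (|t| * |ln x|)] of the remainder stays within the growth allowed for
   weights. *)
apply C_derivable_quadratic with (D := D) (d := Re s / 2) (K := 4 * K); [lra|].
intros z Hz; set (t := (z - s)%C) in *.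
assert (Hz0 : 0 < Re z).
{ assert (Ht := re_le_Cmod t); apply Rabs_le_between in Ht.
  replace (Re t) with (Re z - Re s) in Ht by (unfold t, Re; simpl; ring); lra. }
destruct (H (fun x => Rcpow x t - 1 - t * RtoC (ln x))%C (4 * (Cmod t * Cmod t))) as [l [Hl Hb]].
{ intros x Hx; apply continuous_C_pair; unfold Rcpow, Re, Im; simpl;
  apply (ex_derive_continuous (K := R_AbsRing) (V := R_NormedModule));
  auto_derive; auto. }
{ intros x Hx; apply Rle_trans with (1 := Rcpow_remainder x t).
  assert (Ht := Cmod_ge_0 t).
  apply Rmult_le_compat_l; [nra|].
  apply Rmult_le_compat; [nra|apply Rlt_le, exp_pos|lra|].
  assert (Cmod t * Rabs (ln x) <= Re s / 2 * Rabs (ln x)).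
  { apply Rmult_le_compat_r; [apply Rabs_pos|lra]. }
  destruct (Rle_lt_or_eq_dec _ _ H0) as [H1| ->]; [|lra].
  apply Rlt_le, exp_increasing, H1. }
assert (E : Mellin f z = (Mellin f s + t * D + l)%C).
{ apply is_int0_unique.
  assert (I1 := is_int0_plus _ _ _ _
    (is_int0_plus _ _ _ _ (is_int0_Mellin f s Hf Hs) (is_int0_Cmult _ t _ HD)) Hl).
  revert I1; apply is_int0_ext; intros x Hx.
  replace (z - 1)%C with (s - 1 + t)%C by (unfold t; ring).
  rewrite Rcpow_plus; ringC. }
rewrite E; replace (Mellin f s + t * D + l - Mellin f s - t * D)%C with l by ringC.
lra.
Qed.

Lemma locally_Re_gt (c : R) (s : C) : c < Re s -> locally s (fun z => c < Re z).
Proof.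
intros Hs; assert (H0 : 0 < Re s - c) by lra.
apply locally_Cmod; exists (mkposreal _ H0); simpl; intros z Hz.
assert (Ht := re_le_Cmod (z - s)); apply Rabs_le_between in Ht.
replace (Re (z - s)%C) with (Re z - Re s) in Ht by (unfold Re; simpl; ring); lra.
Qed.

Lemma analytic_at_Mellin (f : R -> R) (s : C) : exp_decay f -> 0 < Re s ->
  analytic_at (Mellin f) s.
Proof.
intros Hf Hs; generalize (locally_Re_gt 0 s Hs).
apply (filter_imp (F := locallyC s)); intros z Hz.
apply C_derivable_Mellin; assumption.
Qed.

(** * The Gamma function *)

Lemma exp_decay_exp : exp_decay (fun x => exp (- x)).
Proof.
split.
- intros x _; apply (ex_derive_continuous (K := R_AbsRing) (V := R_NormedModule)); auto_derive;
  exact I.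
- exists 1; split; [lra|]; intros x Hx; rewrite Rabs_pos_eq, Rmult_1_l by apply Rlt_le, exp_pos.
  apply Rlt_le, exp_increasing; lra.
Qed.

Lemma is_int0_Gamma (s : C) : 0 < Re s ->
  is_int0 (fun x => Rcpow x (s - 1) * RtoC (exp (- x)))%C (Gamma s).
Proof. apply (is_int0_Mellin (fun x => exp (- x))), exp_decay_exp. Qed.

(** Since [|ln x|] is unbounded at both ends, one logarithmic bound yields both limits. It disposes
    of the boundary terms in the integration by parts for [Gamma]. *)
Lemma vanishing_at_0_oo (G : R -> R) (K : R) :
  (forall x, 0 < x -> Rabs (G x) * (1 + ln x * ln x) <= K) ->
  filterlim G (at_right 0) (locally 0) /\ filterlim G (Rbar_locally p_infty) (locally 0).
Proof.
intros H.
assert (Hb : forall (eps : posreal) x, 0 < x -> Rabs K / eps < Rabs (ln x) -> Rabs (G x) < eps).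
{ intros eps x Hx Hl; assert (He := cond_pos eps); specialize (H x Hx).
  assert (E : ln x * ln x = Rabs (ln x) * Rabs (ln x))
    by (rewrite <- Rabs_mult, Rabs_pos_eq; nra).
  rewrite E in H; set (u := Rabs (ln x)) in *.
  assert (Hu : 0 <= u) by apply Rabs_pos.
  assert (Rabs K < u * eps).
  { apply (Rmult_lt_compat_r eps) in Hl; [|exact He].
    replace (Rabs K / eps * eps) with (Rabs K) in Hl by (field; lra); exact Hl. }
  assert (HK := Rle_abs K).
  destruct (Rlt_le_dec (Rabs (G x)) eps) as [|Hg]; [assumption|exfalso].
  assert (eps * (1 + u * u) <= Rabs (G x) * (1 + u * u)) by (apply Rmult_le_compat_r; nra).
  assert (u <= 1 + u * u) by nra.
  assert (u * eps <= (1 + u * u) * eps) by (apply Rmult_le_compat_r; lra).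
  lra. }
split; apply filterlim_locally; intros eps.
- assert (L := is_lim_ln_0 _ (ex_intro _ (- (Rabs K / eps)) (fun y Hy => Hy))).
  assert (P : at_right 0 (fun x => 0 < x)) by (exists (mkposreal 1 Rlt_0_1); auto).
  generalize (filter_and (F := at_right 0) _ _ P L).
  apply (filter_imp (F := at_right 0)); intros x [Hx Hl].
  change (Rabs (G x - 0) < eps); rewrite Rminus_0_r; apply Hb; [exact Hx|].
  rewrite <- (Rabs_Ropp (ln x)); apply Rlt_le_trans with (2 := Rle_abs _); lra.
- assert (L := is_lim_ln_p _ (ex_intro _ (Rabs K / eps) (fun y Hy => Hy))).
  assert (P : Rbar_locally p_infty (fun x => 0 < x)) by (exists 0; auto).
  generalize (filter_and (F := Rbar_locally p_infty) _ _ P L).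
  apply (filter_imp (F := Rbar_locally p_infty)); intros x [Hx Hl].
  change (Rabs (G x - 0) < eps); rewrite Rminus_0_r; apply Hb; [exact Hx|].
  apply Rlt_le_trans with (1 := Hl), Rle_abs.
Qed.

Lemma Rcpow_exp_vanishing (s : C) : 0 < Re s ->
  exists K, forall x, 0 < x -> Cmod (Rcpow x s * RtoC (exp (- x)))%C * (1 + ln x * ln x) <= K.
Proof.
intros Hs; destruct (mellin_kernel_bound (Re s) Hs) as [K [HK H]].
exists K; intros x Hx; apply Rle_trans with (2 := H (ln x)).
rewrite exp_ln, Cmod_mult, Cmod_Rcpow, Cmod_R, (Rabs_pos_eq (exp _)) by
  (try apply Rlt_le, exp_pos; exact Hx).
rewrite <- exp_plus.
set (u := ln x).
assert (E1 : exp (Re s * u + - x) <= exp (Re s * u - x / 2)) by (apply Rlt_le, exp_increasing; lra).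
assert (E2 : 1 <= exp (Re s / 2 * Rabs u)).
{ apply Rle_trans with (2 := exp_ineq1_le _); generalize (Rabs_pos u); nra. }
assert (Hp := exp_pos (Re s * u - x / 2)); assert (0 <= u * u) by nra.
apply Rle_trans with (exp (Re s * u - x / 2) * (1 + u * u)).
- apply Rmult_le_compat_r; lra.
- rewrite <- (Rmult_1_r (_ * (1 + u * u))).
  apply Rmult_le_compat; try nra.
  rewrite (Rmult_comm (exp _)); apply Rmult_le_compat_r; nra.
Qed.

Lemma is_int0R_derive_0 (G g : R -> R) :
  (forall x, 0 < x -> is_derive G x (g x)) ->
  (forall x, 0 < x -> continuous g x) ->
  filterlim G (at_right 0) (locally 0) ->
  filterlim G (Rbar_locally p_infty) (locally 0) ->
  is_int0R g 0.
Proof.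
intros HG Hg L0 L1; generalize (is_int0R_derive G g 0 0 HG Hg L0 L1).
rewrite Rminus_0_r; auto.
Qed.

(** The derivative of [x^s e^{-x}] is [s x^{s-1} e^{-x} - x^s e^{-x}], and [x^s e^{-x}] vanishes at
    both ends, so the integral of the derivative is 0. *)
Lemma Gamma_succ (s : C) : 0 < Re s -> Gamma (s + 1) = (s * Gamma s)%C.
Proof.
intros Hs.
assert (Hs1 : 0 < Re (s + 1)%C) by (unfold Re in *; simpl; lra).
assert (I1 := is_int0_plus _ _ _ _ (is_int0_Cmult _ s _ (is_int0_Gamma s Hs))
  (is_int0_Cmult _ (-(1))%C _ (is_int0_Gamma (s + 1) Hs1))).
destruct (Rcpow_exp_vanishing s Hs) as [K HK].
assert (I2 : is_int0 (fun x => s * (Rcpow x (s - 1) * RtoC (exp (- x))) +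
    -(1) * (Rcpow x (s + 1 - 1) * RtoC (exp (- x))))%C (RtoC 0)).
{ apply is_int0_ext with (fun x => ((s * RtoC (/ x) - 1) * (Rcpow x s * RtoC (exp (- x))))%C).
  { intros x Hx.
    replace (s + 1 - 1)%C with s by ring.
    replace (Rcpow x (s - 1)) with (Rcpow x s * RtoC (/ x))%C; [ringC|].
    unfold Cminus; rewrite Rcpow_plus; f_equal.
    replace (- (1))%C with (RtoC (- 1)) by (apply injective_projections; simpl; ring).
    rewrite Rcpow_RtoC; f_equal.
    replace (-1 * ln x) with (- ln x) by ring; rewrite exp_Ropp, exp_ln; auto. }
  apply is_int0_pair; simpl.
  - destruct (vanishing_at_0_oo (fun x => Re (Rcpow x s * RtoC (exp (- x)))%C) K) as [L0 L1].
    { intros x Hx; apply Rle_trans with (2 := HK x Hx).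
      apply Rmult_le_compat_r; [nra|apply re_le_Cmod]. }
    apply is_int0R_derive_0 with (3 := L0) (4 := L1).
    + intros x Hx; unfold Rcpow, Re, Im; simpl; auto_derive; [auto|field; lra].
    + intros x Hx; unfold Rcpow, Re, Im; simpl.
      apply (ex_derive_continuous (K := R_AbsRing) (V := R_NormedModule)); auto_derive.
      repeat split; auto; lra.
  - destruct (vanishing_at_0_oo (fun x => Im (Rcpow x s * RtoC (exp (- x)))%C) K) as [L0 L1].
    { intros x Hx; apply Rle_trans with (2 := HK x Hx).
      apply Rmult_le_compat_r; [nra|].
      apply Rle_trans with (2 := Rmax_Cmod _), Rmax_r. }
    apply is_int0R_derive_0 with (3 := L0) (4 := L1).
    + intros x Hx; unfold Rcpow, Re, Im; simpl; auto_derive; [auto|field; lra].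
    + intros x Hx; unfold Rcpow, Re, Im; simpl.
      apply (ex_derive_continuous (K := R_AbsRing) (V := R_NormedModule)); auto_derive.
      repeat split; auto; lra. }
apply is_int0_unique in I1; apply is_int0_unique in I2; rewrite I1 in I2.
replace (Gamma (s + 1)) with (s * Gamma s - (s * Gamma s + -(1) * Gamma (s + 1)))%C by ring.
rewrite I2; ring.
Qed.

(** * Nonvanishing of [Gamma] on the right half-plane *)

Lemma is_int0R_le (f g : R -> R) (lf lg : R) :
  (forall x, 0 < x -> f x <= g x) -> is_int0R f lf -> is_int0R g lg -> lf <= lg.
Proof.
intros H Hf Hg.
assert (I1 := is_RInt_gen_minus (V := R_NormedModule) g f lg lf Hg Hf).
(* The nonnegative function [g - f] dominates its own norm, so monotonicity follows from the norm
   inequality for integrals. *)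
assert (norm (minus (lg : R_NormedModule) lf) <= minus (lg : R_NormedModule) lf).
{ apply (RInt_gen_norm (V := R_CompleteNormedModule) (Fa := at_right 0) (Fb := Rbar_locally p_infty)
    (fun x => minus (g x) (f x)) (fun x => minus (g x) (f x))); auto.
  - apply filter_prod_pos; simpl; intros; lra.
  - apply filter_prod_pos; simpl; intros a b Ha Ha1 Hb x Hx.
    change (Rabs (g x - f x) <= g x - f x).
    rewrite Rabs_pos_eq; [lra|]; specialize (H x); lra. }
change (Rabs (lg - lf) <= lg - lf) in H0.
generalize (Rabs_pos (lg - lf)); lra.
Qed.

Lemma is_int0R_Gamma (r : R) : 0 < r ->
  is_int0R (fun x => exp ((r - 1) * ln x) * exp (- x)) (Re (Gamma (RtoC r))).
Proof.
intros Hr; generalize (is_int0_fst _ _ (is_int0_Gamma (RtoC r) Hr)).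
apply (is_int0_ext R_NormedModule); intros x Hx.
replace (RtoC r - 1)%C with (RtoC (r - 1)) by (apply injective_projections; simpl; ring).
rewrite Rcpow_RtoC; simpl; ring.
Qed.

Lemma Re_Gamma_succ (r : R) : 0 < r -> Re (Gamma (RtoC (r + 1))) = r * Re (Gamma (RtoC r)).
Proof.
intros Hr.
replace (RtoC (r + 1)) with (RtoC r + 1)%C by (apply injective_projections; simpl; ring).
rewrite Gamma_succ by exact Hr; unfold Re; simpl; ring.
Qed.

Lemma Gamma_1 : Re (Gamma (RtoC 1)) = 1.
Proof.
assert (I1 := is_int0R_Gamma 1 Rlt_0_1).
assert (I2 : is_int0R (fun x => exp (- x)) (0 - - exp (- 0))).
{ apply is_int0R_derive with (fun x => - exp (- x)).
  - intros x _; auto_derive; [exact I|ring].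
  - intros x _; apply (ex_derive_continuous (K := R_AbsRing) (V := R_NormedModule)); auto_derive;
    exact I.
  - apply (filterlim_filter_le_1 (F := locally 0) (G := at_right 0)).
    { intros P; apply (filter_imp (F := locally 0)); auto. }
    apply (ex_derive_continuous (K := R_AbsRing) (V := R_NormedModule) (fun x => - exp (- x)) 0).
    auto_derive; exact I.
  - apply filterlim_locally; intros eps.
    exists (Rmax 0 (- ln eps)); intros x Hx.
    assert (H1 := Rmax_l 0 (- ln eps)); assert (H2 := Rmax_r 0 (- ln eps)).
    change (Rabs (- exp (- x) - 0) < eps).
    rewrite Rminus_0_r, Rabs_Ropp, Rabs_pos_eq by apply Rlt_le, exp_pos.
    rewrite <- (exp_ln eps) by apply cond_pos; apply exp_increasing; lra. }
rewrite Ropp_0, exp_0 in I2.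
replace (0 - - (1)) with 1 in I2 by ring.
apply Rle_antisym; [refine (is_int0R_le _ _ _ _ _ I1 I2)|refine (is_int0R_le _ _ _ _ _ I2 I1)];
intros x _; replace ((1 - 1) * ln x) with 0 by ring; rewrite exp_0; lra.
Qed.

Lemma ln_ge_1_sub_inv (x : R) : 0 < x -> 1 - / x <= ln x.
Proof.
intros Hx; assert (Hi := Rinv_0_lt_compat x Hx).
assert (H := exp_ineq1_le (ln (/ x))).
rewrite exp_ln, ln_Rinv in H by assumption; lra.
Qed.

(** With [p = r - 1 >= 1], Bernoulli's inequality [x^p >= p x - (p - 1)] integrated against [e^{-x}]
    gives [Gamma r >= p * Gamma 2 - (p - 1) * Gamma 1 = 1]. *)
Lemma Re_Gamma_ge_1 (r : R) : 2 <= r -> 1 <= Re (Gamma (RtoC r)).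
Proof.
intros Hr; set (p := r - 1).
assert (G2 : Re (Gamma (RtoC 2)) = 1).
{ replace 2 with (1 + 1) by ring; rewrite Re_Gamma_succ, Gamma_1; lra. }
assert (I1 := is_int0R_Gamma 1 Rlt_0_1); assert (I2 := is_int0R_Gamma 2 Rlt_0_2).
assert (Hr0 : 0 < r) by lra; assert (I3 := is_int0R_Gamma r Hr0).
rewrite Gamma_1 in I1; rewrite G2 in I2.
assert (I4 := is_RInt_gen_minus (V := R_NormedModule) _ _ _ _
  (is_RInt_gen_scal (V := R_NormedModule) _ p _ I2)
  (is_RInt_gen_scal (V := R_NormedModule) _ (p - 1) _ I1)).
apply Rle_trans with (p * 1 - (p - 1) * 1); [right; ring|].
refine (is_int0R_le _ _ _ _ _ I4 I3); intros x Hx.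
change (p * (exp ((2 - 1) * ln x) * exp (- x)) -
  (p - 1) * (exp ((1 - 1) * ln x) * exp (- x)) <= exp (p * ln x) * exp (- x)).
replace ((1 - 1) * ln x) with 0 by ring; rewrite exp_0.
replace ((2 - 1) * ln x) with (ln x) by ring.
replace (p * (exp (ln x) * exp (- x)) - (p - 1) * (1 * exp (- x)))
  with ((p * exp (ln x) - (p - 1)) * exp (- x)) by ring.
apply Rmult_le_compat_r; [apply Rlt_le, exp_pos|].
replace (p * ln x) with (ln x + (p - 1) * ln x) by ring.
rewrite exp_plus, exp_ln by exact Hx.
assert (H1 := exp_ineq1_le ((p - 1) * ln x)).
assert (H2 := ln_ge_1_sub_inv x Hx).
assert (H3 : (p - 1) * (1 - / x) <= (p - 1) * ln x) by (apply Rmult_le_compat_l; unfold p; lra).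
apply Rle_trans with (x * (1 + (p - 1) * (1 - / x))).
- right; field; lra.
- apply Rmult_le_compat_l; lra.
Qed.

(** At [v = ln (x / S)] the right-hand side is [x / S - 2 + S / x], whose integral against the
    density [x^{S-1} e^{-x}] is known from [Gamma] at [S + 1], [S] and [S - 1]. The inequality
    follows from [sinh w >= w] at [w = v / 2], up to the sign of [v]. *)
Lemma sqr_le_cosh (v : R) : v * v <= exp v - 2 + exp (- v).
Proof.
assert (H : forall w, 0 <= w -> 2 * w <= exp w - exp (- w)).
{ intros w Hw.
  destruct (MVT_gen (fun x => exp x - exp (- x) - 2 * x) 0 w
    (fun x => exp x + exp (- x) - 2)) as [c [Hc E]].
  - intros x _; auto_derive; [exact I|ring].
  - intros x _; apply derivable_continuous_pt.
    exists (exp x + exp (- x) - 2); apply is_derive_Reals; auto_derive; [exact I|ring].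
  - rewrite Ropp_0 in E.
    assert (0 <= exp c + exp (- c) - 2).
    { replace c with (c / 2 + c / 2) by field.
      replace (- (c / 2 + c / 2)) with (- (c / 2) + - (c / 2)) by ring.
      rewrite !exp_plus.
      assert (exp (c / 2) * exp (- (c / 2)) = 1) by (rewrite <- exp_plus, Rplus_opp_r; apply exp_0).
      generalize (Rle_0_sqr (exp (c / 2) - exp (- (c / 2)))); unfold Rsqr; nra. }
    rewrite Rminus_0_r, exp_0 in E.
    assert (0 <= (exp c + exp (- c) - 2) * w) by (apply Rmult_le_pos; assumption).
    lra. }
assert (H2 : forall w, 0 <= w -> w * w <= exp w - 2 + exp (- w)).
{ intros w Hw; assert (Hw2 := H (w / 2) ltac:(lra)).
  replace w with (w / 2 + w / 2) by field.
  replace (- (w / 2 + w / 2)) with (- (w / 2) + - (w / 2)) by ring.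
  rewrite !exp_plus.
  assert (exp (w / 2) * exp (- (w / 2)) = 1) by (rewrite <- exp_plus, Rplus_opp_r; apply exp_0).
  nra. }
destruct (Rle_lt_dec 0 v) as [Hv|Hv]; [apply H2, Hv|].
assert (H3 := H2 (- v) ltac:(lra)); rewrite Ropp_involutive in H3; lra.
Qed.

(* After multiplication by [S ^ (- i t)], the integrand of [Gamma (S + i t)] has
   real part [x ^ (S - 1) * exp (- x) * cos (t * ln (x / S))], and the density is
   so concentrated around [x = S] that the cosine stays close to 1. *)
Lemma Gamma_neq_0_large (S t : R) : 2 < S -> t * t < S - 1 -> Gamma (S, t) <> RtoC 0.
Proof.
intros HS Ht E.
assert (HS0 : 0 < S) by lra.
set (c := (cos (t * ln S), - sin (t * ln S)) : C).
assert (I1 := is_int0_fst _ _ (is_int0_Cmult _ c _ (is_int0_Gamma (S, t) HS0))).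
rewrite E in I1.
replace (Re (c * 0)%C) with 0 in I1 by (unfold Re; simpl; ring).
assert (HS1 : 0 < S + 1) by lra; assert (HSm : 0 < S - 1) by lra.
assert (J0 := is_int0R_Gamma S HS0); assert (J1 := is_int0R_Gamma (S + 1) HS1).
assert (Jm := is_int0R_Gamma (S - 1) HSm).
assert (Hg := Re_Gamma_ge_1 S ltac:(lra)).
assert (E1 := Re_Gamma_succ S HS0); assert (Em := Re_Gamma_succ (S - 1) HSm).
replace (S - 1 + 1) with S in Em by ring.
rewrite E1 in J1.
set (g := Re (Gamma (RtoC S))) in *; set (gm := Re (Gamma (RtoC (S - 1)))) in *.
(* The minorant is [1 - t^2 / 2 * (x / S - 2 + S / x)], from [cos y >= 1 - y^2 / 2] and
   [sqr_le_cosh]. By the functional equation its integral is [Gamma (S - 1) * (S - 1 - t^2 / 2)],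
   which is positive, whereas a zero of [Gamma] would force it to be at most 0. *)
assert (J := is_RInt_gen_minus (V := R_NormedModule) _ _ _ _
  (is_RInt_gen_scal (V := R_NormedModule) _ (1 + t * t) _ J0)
  (is_RInt_gen_scal (V := R_NormedModule) _ (t * t / 2) _
    (is_RInt_gen_plus (V := R_NormedModule) _ _ _ _
      (is_RInt_gen_scal (V := R_NormedModule) _ (/ S) _ J1)
      (is_RInt_gen_scal (V := R_NormedModule) _ S _ Jm)))).
assert (H : (1 + t * t) * g - t * t / 2 * (/ S * (S * g) + S * gm) <= 0).
{ refine (is_int0R_le _ _ _ _ _ J I1); intros x Hx.
  change ((1 + t * t) * (exp ((S - 1) * ln x) * exp (- x)) - t * t / 2 *
    (/ S * (exp ((S + 1 - 1) * ln x) * exp (- x)) + S * (exp ((S - 1 - 1) * ln x) * exp (- x)))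
    <= Re (c * (Rcpow x ((S, t) - 1) * RtoC (exp (- x))))%C).
  replace ((S + 1 - 1) * ln x) with ((S - 1) * ln x + ln x) by ring.
  replace ((S - 1 - 1) * ln x) with ((S - 1) * ln x + - ln x) by ring.
  rewrite !exp_plus, (exp_Ropp (ln x)), exp_ln by exact Hx.
  replace (Re (c * (Rcpow x ((S, t) - 1) * RtoC (exp (- x))))%C)
    with (exp ((S - 1) * ln x) * exp (- x) * cos (t * ln x - t * ln S)).
  2:{ rewrite cos_minus; unfold c, Rcpow, Re, Im; simpl.
      replace (t + - 0) with t by ring; replace (S + - (1)) with (S - 1) by ring; ring. }
  set (w := exp ((S - 1) * ln x)); set (e := exp (- x)).
  replace ((1 + t * t) * (w * e) - t * t / 2 * (/ S * (w * x * e) + S * (w * / x * e)))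
    with (w * e * (1 - t * t / 2 * (x * / S - 2 + / x * S))) by (field; lra).
  apply Rmult_le_compat_l; [apply Rmult_le_pos; apply Rlt_le, exp_pos|].
  assert (Q := sqr_le_cosh (ln x - ln S)).
  replace (exp (ln x - ln S)) with (x * / S) in Q
    by (unfold Rminus; rewrite exp_plus, exp_Ropp, !exp_ln by lra; reflexivity).
  replace (exp (- (ln x - ln S))) with (/ x * S) in Q
    by (rewrite Ropp_minus_distr; unfold Rminus;
        rewrite exp_plus, exp_Ropp, !exp_ln by lra; ring).
  assert (C1 := cos_sub1_bound (t * ln x - t * ln S)).
  apply Rabs_le_between in C1.
  replace ((t * ln x - t * ln S) * (t * ln x - t * ln S) / 2)
    with (t * t / 2 * ((ln x - ln S) * (ln x - ln S))) in C1 by field.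
  assert (Q2 : t * t / 2 * ((ln x - ln S) * (ln x - ln S)) <= t * t / 2 * (x * / S - 2 + / x * S))
    by (apply Rmult_le_compat_l; nra).
  lra. }
replace (/ S * (S * g)) with g in H by (field; lra).
assert (P : (1 + t * t) * g - t * t / 2 * (g + S * gm) = gm * (S - 1 - t * t / 2)) by (rewrite Em; field).
rewrite P in H.
assert (0 < gm) by (rewrite Em in Hg; nra).
assert (0 <= t * t) by nra; nra.
Qed.

(* The functional equation moves a zero arbitrarily far to the right. *)
Lemma Gamma_neq_0 (s : C) : 0 < Re s -> Gamma s <> RtoC 0.
Proof.
intros Hs E.
assert (Hk : forall k, Gamma (s + RtoC (INR k))%C = RtoC 0).
{ induction k as [|k IH].
  - replace (s + RtoC (INR 0))%C with s by (simpl; ring); exact E.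
  - rewrite S_INR, RtoC_plus, Cplus_assoc, Gamma_succ.
    + rewrite IH; ring.
    + assert (H := pos_INR k); unfold Re in *; simpl; lra. }
(* The shifted real part then exceeds both 2 and [1 + Im s * Im s]. *)
destruct (INR_unbounded (3 + Im s * Im s)) as [k Hlt].
apply (Gamma_neq_0_large (Re s + INR k) (Im s)); [nra|nra|].
rewrite <- (Hk k); f_equal.
apply injective_projections; unfold Re, Im; simpl; ring.
Qed.

(** * Analytic continuation *)

Definition exp_series_at_0 (f : R -> R) (d : nat -> R) : Prop :=
  exists r, 0 < r /\ forall x, 0 < x < r -> is_pseries d x (f x * exp x).

(** Strictly outside the disc of convergence the terms do not tend to 0. The midpoint of [|x|] and
    [r], where the series converges, is therefore not outside, and [|x|] is strictly smaller than
    it. *)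
Lemma CV_radius_ge (d : nat -> R) (r : R) : 0 < r ->
  (forall x, 0 < x < r -> ex_pseries d x) ->
  forall x, Rabs x < r -> Rbar_lt (Rabs x) (CV_radius d).
Proof.
intros Hr H x Hx; assert (Hp := Rabs_pos x).
set (y := (Rabs x + r) / 2).
assert (Hy : 0 < y < r) by (unfold y; lra).
apply Rbar_lt_le_trans with (Finite y); [simpl; unfold y; lra|].
destruct (Rbar_le_lt_dec y (CV_radius d)) as [|Hl]; [assumption|exfalso].
rewrite <- (Rabs_pos_eq y) in Hl by lra.
apply (CV_disk_outside d y Hl).
apply ex_series_lim_0, ex_pseries_R, H, Hy.
Qed.

(* Subtracting [d 0 * exp (- x)] and dividing by [x] shifts the coefficients
   of [f x * exp x]. *)
Definition step_fun (f : R -> R) (c x : R) : R := (f x - c * exp (- x)) / x.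

Lemma exp_series_step (f : R -> R) (d : nat -> R) :
  exp_series_at_0 f d -> exp_series_at_0 (step_fun f (d 0%nat)) (PS_decr_1 d).
Proof.
intros [r [Hr H]]; exists r; split; [exact Hr|]; intros x Hx.
assert (Hd : is_pseries (PS_decr_1 d) x (scal (/ x) (plus (f x * exp x) (opp (d 0%nat))))).
{ apply (is_pseries_decr_1 (K := R_AbsRing) (V := R_NormedModule) d x (/ x)); [|apply H, Hx].
  change (/ x * x = 1); field; lra. }
replace (step_fun f (d 0%nat) x * exp x) with (/ x * (f x * exp x + - d 0%nat)); [exact Hd|].
unfold step_fun; rewrite exp_Ropp; field; split; [apply Rgt_not_eq, exp_pos|lra].
Qed.

(** On the compact interval up to half the radius, [f x] is [exp (- x)] times a continuous function.
    Applied to a stripped function, this shows that the division by [x] creates no singularity at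
    0. *)
Lemma exp_series_bounded (f : R -> R) (d : nat -> R) : exp_series_at_0 f d ->
  exists r M, 0 < r /\ 0 < M /\ forall x, 0 < x <= r -> Rabs (f x) <= M * exp (- x / 2).
Proof.
intros [r [Hr H]].
assert (HR : forall x, Rabs x < r -> Rbar_lt (Rabs x) (CV_radius d)).
{ apply CV_radius_ge; [exact Hr|]; intros x Hx; eexists; apply (H x Hx). }
destruct (continuity_ab_maj (fun x => Rabs (PSeries d x)) 0 (r / 2)) as [xm [Hm _]]; [lra| |].
{ intros c Hc; apply continuity_pt_comp with (f2 := Rabs).
  - apply (PSeries_continuity d c), HR; rewrite Rabs_pos_eq; lra.
  - apply Rcontinuity_abs. }
exists (r / 2), (Rabs (PSeries d xm) + 1); repeat split;
[lra|generalize (Rabs_pos (PSeries d xm)); lra|].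
intros x Hx.
assert (E := is_pseries_unique _ _ _ (H x ltac:(lra))).
replace (f x) with (PSeries d x * exp (- x)).
2:{ rewrite E, Rmult_assoc, <- exp_plus, Rplus_opp_r, exp_0; ring. }
rewrite Rabs_mult, (Rabs_pos_eq (exp _)) by apply Rlt_le, exp_pos.
apply Rmult_le_compat; [apply Rabs_pos|apply Rlt_le, exp_pos| |].
- specialize (Hm x ltac:(lra)); simpl in Hm; lra.
- apply Rlt_le, exp_increasing; lra.
Qed.

(** Near 0 the power series bounds the quotient; beyond [r] the division by [x] costs at most the
    factor [/ r]. *)
Lemma exp_decay_step (f : R -> R) (d : nat -> R) :
  exp_decay f -> exp_series_at_0 f d -> exp_decay (step_fun f (d 0%nat)).
Proof.
intros [Hc [K [HK Hf]]] Hs.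
destruct (exp_series_bounded _ _ (exp_series_step f d Hs)) as [r [M [Hr [HM Hb]]]].
split.
- intros x Hx; unfold step_fun.
  apply (continuous_mult (K := R_AbsRing) (fun x => f x - d 0%nat * exp (- x)) (fun x => / x)).
  + apply (continuous_minus (V := R_NormedModule)); [apply Hc, Hx|].
    apply (ex_derive_continuous (K := R_AbsRing) (V := R_NormedModule)); auto_derive; exact I.
  + apply (ex_derive_continuous (K := R_AbsRing) (V := R_NormedModule)); auto_derive; lra.
- set (L := (K + Rabs (d 0%nat)) / r).
  assert (Hd := Rabs_pos (d 0%nat)).
  assert (HL : 0 < L) by (apply Rdiv_lt_0_compat; lra).
  exists (M + L); split; [lra|]; intros x Hx.
  assert (He := exp_pos (- x / 2)).
  destruct (Rle_lt_dec x r) as [Hxr|Hxr].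
  + apply Rle_trans with (1 := Hb x (conj Hx Hxr)); nra.
  + apply Rle_trans with (L * exp (- x / 2)); [|nra].
    unfold step_fun, Rdiv at 1; rewrite Rabs_mult, Rabs_inv, (Rabs_pos_eq x) by lra.
    apply Rle_trans with ((K + Rabs (d 0%nat)) * exp (- x / 2) * / r).
    2:{ right; unfold L; field; lra. }
    apply Rmult_le_compat; [apply Rabs_pos|apply Rlt_le, Rinv_0_lt_compat, Hx| |].
    * apply Rle_trans with (1 := Rabs_triang _ _).
      rewrite Rabs_Ropp, Rabs_mult, (Rabs_pos_eq (exp _)) by apply Rlt_le, exp_pos.
      rewrite Rmult_plus_distr_r; apply Rplus_le_compat; [apply Hf, Hx|].
      apply Rmult_le_compat_l; [exact Hd|]; apply Rlt_le, exp_increasing; lra.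
    * apply Rinv_le_contravar; lra.
Qed.

(** From [f x = d 0 * exp (- x) + x * step_fun f (d 0) x], where the factor [x] raises the exponent
    by one. *)
Lemma Mellin_step (f : R -> R) (d : nat -> R) (s : C) :
  exp_decay f -> exp_series_at_0 f d -> 0 < Re s ->
  Mellin f s = (RtoC (d 0%nat) * Gamma s + Mellin (step_fun f (d 0%nat)) (s + 1))%C.
Proof.
intros Hf Hd Hs.
assert (Hs1 : 0 < Re (s + 1)%C) by (unfold Re in *; simpl; lra).
apply is_int0_unique.
generalize (is_int0_plus _ _ _ _ (is_int0_Cmult _ (RtoC (d 0%nat)) _ (is_int0_Gamma s Hs))
  (is_int0_Mellin _ _ (exp_decay_step f d Hf Hd) Hs1)).
apply is_int0_ext; intros x Hx.
replace (s + 1 - 1)%C with (s - 1 + RtoC 1)%C by ring.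
rewrite Rcpow_plus, Rcpow_RtoC, Rmult_1_l, exp_ln by exact Hx.
replace (RtoC (f x)) with (RtoC (d 0%nat) * RtoC (exp (- x)) + RtoC x * RtoC (step_fun f (d 0%nat) x))%C; [ringC|].
rewrite <- !RtoC_mult, <- RtoC_plus; f_equal; unfold step_fun; field; lra.
Qed.

Fixpoint rem_fun (f : R -> R) (d : nat -> R) (k : nat) : R -> R :=
  match k with
  | O => f
  | S k' => step_fun (rem_fun f d k') (d k')
  end.

Lemma rem_fun_spec (f : R -> R) (d : nat -> R) (k : nat) :
  exp_decay f -> exp_series_at_0 f d ->
  exp_decay (rem_fun f d k) /\ exp_series_at_0 (rem_fun f d k) (PS_decr_n d k).
Proof.
intros Hf Hd; induction k as [|k [IH1 IH2]]; [split; assumption|].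
assert (E : d k = PS_decr_n d k 0%nat) by (unfold PS_decr_n; f_equal; lia).
simpl; rewrite E at 1 2; split.
- apply exp_decay_step; assumption.
- destruct (exp_series_step _ _ IH2) as [r [Hr H]]; exists r; split; [exact Hr|].
  intros x Hx; apply is_pseries_ext with (2 := H x Hx).
  intros n; unfold PS_decr_1, PS_decr_n; f_equal; lia.
Qed.

Fixpoint Cpoch (s : C) (k : nat) : C :=
  match k with
  | O => RtoC 1
  | S k' => (Cpoch s k' * (s + RtoC (INR k')))%C
  end.

Lemma Gamma_poch (s : C) (k : nat) : 0 < Re s ->
  Gamma (s + RtoC (INR k)) = (Cpoch s k * Gamma s)%C.
Proof.
intros Hs; induction k as [|k IH].
- simpl; replace (s + 0)%C with s by ring; ring.
- rewrite S_INR, RtoC_plus, Cplus_assoc, Gamma_succ.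
  + rewrite IH; simpl; ring.
  + assert (H := pos_INR k); unfold Re in *; simpl; lra.
Qed.

Fixpoint poch_sum (d : nat -> R) (s : C) (k : nat) : C :=
  match k with
  | O => RtoC 0
  | S k' => (poch_sum d s k' + RtoC (d k') * Cpoch s k')%C
  end.

(* [Mellin f s / Gamma s] continued to [- k < Re s] by [k] steps. *)
Definition mellin_ratio_strip (f : R -> R) (d : nat -> R) (k : nat) (s : C) : C :=
  (poch_sum d s k +
   Cpoch s k * (Mellin (rem_fun f d k) (s + RtoC (INR k)) * / Gamma (s + RtoC (INR k))))%C.

(** Any [k] with [- k < Re s] gives the same value, and [up (- Re s)] is such a number; [Z.to_nat]
    sends negative ones to 0. *)
Definition mellin_ratio (f : R -> R) (d : nat -> R) (s : C) : C :=
  mellin_ratio_strip f d (Z.to_nat (up (- Re s))) s.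

Section Continuation.
Variables (f : R -> R) (d : nat -> R).
Hypotheses (Hf : exp_decay f) (Hd : exp_series_at_0 f d).

(** At [w = s + k], the stripped term [d k * Gamma w] divided by [Gamma w] is the next summand of
    [poch_sum]. In the remainder [/ Gamma w = w * / Gamma (w + 1)], and this [w] is the next factor
    of [Cpoch]. *)
Lemma mellin_ratio_strip_succ (k : nat) (s : C) : - INR k < Re s ->
  mellin_ratio_strip f d (S k) s = mellin_ratio_strip f d k s.
Proof.
intros Hs; set (w := (s + RtoC (INR k))%C).
assert (Hw : 0 < Re w) by (unfold w, Re in *; simpl; lra).
destruct (rem_fun_spec f d k Hf Hd) as [H1 H2].
assert (E : d k = PS_decr_n d k 0%nat) by (unfold PS_decr_n; f_equal; lia).
unfold mellin_ratio_strip; fold w.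
rewrite (Mellin_step _ _ w H1 H2 Hw), <- E, S_INR, RtoC_plus, Cplus_assoc; fold w.
rewrite Gamma_succ by exact Hw.
cbn [poch_sum Cpoch rem_fun]; fold w.
assert (HG := Gamma_neq_0 w Hw).
assert (Hw0 : w <> RtoC 0) by (intros E0; rewrite E0 in Hw; unfold Re in Hw; simpl in Hw; lra).
field; auto.
Qed.

Lemma mellin_ratioE (k : nat) (s : C) : - INR k < Re s ->
  mellin_ratio f d s = mellin_ratio_strip f d k s.
Proof.
intros Hs.
assert (Hk : forall j, - INR j < Re s -> forall i, mellin_ratio_strip f d (i + j) s = mellin_ratio_strip f d j s).
{ intros j Hj i; induction i as [|i IH]; [reflexivity|].
  rewrite <- IH; apply mellin_ratio_strip_succ.
  rewrite plus_INR; generalize (pos_INR i); lra. }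
set (m := Z.to_nat (up (- Re s))).
assert (Hm : - INR m < Re s).
{ destruct (archimed (- Re s)) as [H1 _].
  assert (IZR (up (- Re s)) <= INR m); [|lra].
  unfold m; rewrite INR_IZR_INZ; apply IZR_le; lia. }
unfold mellin_ratio; fold m.
rewrite <- (Hk m Hm k), <- (Hk k Hs m); f_equal; lia.
Qed.

Lemma mellin_ratio_init (s : C) : 0 < Re s ->
  mellin_ratio f d s = (Mellin f s * / Gamma s)%C.
Proof.
intros Hs; rewrite (mellin_ratioE 0) by (simpl; lra).
unfold mellin_ratio_strip; simpl; replace (s + 0)%C with s by ring; ring.
Qed.

Lemma factorable_Cpoch (k : nat) (a : C) : factorable (fun s => Cpoch s k) a.
Proof.
induction k as [|k IH]; [apply (factorable_const (RtoC 1))|].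
apply (factorable_mult _ (fun s => s + RtoC (INR k))%C); [exact IH|].
apply factorable_plus; [apply factorable_id|apply factorable_const].
Qed.

Lemma factorable_poch_sum (k : nat) (a : C) : factorable (fun s => poch_sum d s k) a.
Proof.
induction k as [|k IH]; [apply (factorable_const (RtoC 0))|].
apply (factorable_plus _ (fun s => RtoC (d k) * Cpoch s k)%C); [exact IH|].
apply (factorable_mult (fun _ => RtoC (d k))); [apply factorable_const|apply factorable_Cpoch].
Qed.

Lemma analytic_at_strip_tail (k : nat) (s : C) : - INR k < Re s ->
  analytic_at (fun s => Mellin (rem_fun f d k) (s + RtoC (INR k)) * / Gamma (s + RtoC (INR k)))%C s.
Proof.
intros Hs.
assert (Hw : 0 < Re (s + RtoC (INR k))%C) by (unfold Re in *; simpl; lra).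
apply analytic_at_mult.
- apply (analytic_at_shift (Mellin (rem_fun f d k))), analytic_at_Mellin; [|exact Hw].
  apply rem_fun_spec; assumption.
- apply (analytic_at_inv (fun s => Gamma (s + RtoC (INR k)))); [|apply Gamma_neq_0, Hw].
  apply (analytic_at_shift Gamma), (analytic_at_Mellin _ _ exp_decay_exp Hw).
Qed.

Lemma analytic_at_mellin_ratio (s : C) : analytic_at (mellin_ratio f d) s.
Proof.
destruct (INR_unbounded (- Re s)) as [k Hk]; assert (Hs : - INR k < Re s) by lra.
apply analytic_at_ext_loc with (mellin_ratio_strip f d k).
- generalize (locally_Re_gt _ _ Hs); apply (filter_imp (F := locallyC s)).
  intros z Hz; symmetry; apply mellin_ratioE, Hz.
- apply analytic_at_plus; [apply factorable_analytic, factorable_poch_sum|].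
  apply analytic_at_mult; [apply factorable_analytic, factorable_Cpoch|].
  apply analytic_at_strip_tail, Hs.
Qed.

Lemma Cpoch_neg_S (m : nat) : Cpoch (- RtoC (INR m)) (S m) = RtoC 0.
Proof. simpl; ring. Qed.

Lemma mellin_ratio_neg (m : nat) :
  mellin_ratio f d (- RtoC (INR m))%C = poch_sum d (- RtoC (INR m)) (S m).
Proof.
rewrite (mellin_ratioE (S m)) by (rewrite S_INR; unfold Re; simpl; lra).
unfold mellin_ratio_strip; rewrite Cpoch_neg_S; ring.
Qed.

(** With [m + 1] steps the transcendental tail carries the factor [Cpoch s (S m)], which contains
    [s + m]. The difference quotient at [- m] is thus visible, and only analyticity of the tail
    itself is used. *)
Lemma factorable_mellin_ratio (m : nat) :
  factorable (mellin_ratio f d) (- RtoC (INR m)).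
Proof.
set (a := (- RtoC (INR m))%C).
assert (Ha : - INR (S m) < Re a) by (rewrite S_INR; unfold a, Re; simpl; lra).
assert (F : factorable (mellin_ratio_strip f d (S m)) a).
{ apply (factorable_plus (fun s => poch_sum d s (S m))); [apply factorable_poch_sum|].
  assert (Ht := analytic_at_strip_tail (S m) a Ha); revert Ht.
  set (t := fun s => (Mellin (rem_fun f d (S m)) (s + RtoC (INR (S m))) * / Gamma (s + RtoC (INR (S m))))%C).
  intros Ht; exists (fun s => Cpoch s m * t s)%C; split.
  - apply analytic_at_mult; [apply factorable_analytic, factorable_Cpoch|exact Ht].
  - apply (filter_forall (F := locallyC a)); intros z.
    unfold a at 1; rewrite Cpoch_neg_S; fold (t z); unfold a; simpl; ringC. }
destruct F as [q [Hq E]]; exists q; split; [exact Hq|].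
generalize (filter_and (F := locallyC a) _ _ E (locally_Re_gt _ _ Ha)).
apply (filter_imp (F := locallyC a)); intros z [E1 E2].
rewrite (mellin_ratioE (S m) z E2), (mellin_ratioE (S m) a Ha); exact E1.
Qed.

End Continuation.

(** * The generating function of the generalized Bernoulli numbers *)

(** A binomial coefficient is at most [2 ^ (n + k)], by induction along Pascal's rule. *)
Lemma fact_add_le (n k : nat) : (fact (n + k) <= 2 ^ (n + k) * (fact n * fact k))%nat.
Proof.
remember (n + k)%nat as m eqn:E; revert n k E.
induction m as [|m IH]; intros n k E.
- replace n with 0%nat by lia; replace k with 0%nat by lia; simpl; lia.
- assert (Hp : (1 <= 2 ^ S m)%nat) by (generalize (Nat.pow_nonzero 2 (S m)); lia).
  destruct n as [|n]; [|destruct k as [|k]].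
  + replace k with (S m) by lia; change (fact 0) with 1%nat.
    rewrite Nat.mul_1_l, <- (Nat.mul_1_l (fact (S m))) at 1.
    apply Nat.mul_le_mono_r, Hp.
  + replace (S n) with (S m) by lia; change (fact 0) with 1%nat.
    rewrite Nat.mul_1_r, <- (Nat.mul_1_l (fact (S m))) at 1.
    apply Nat.mul_le_mono_r, Hp.
  + assert (H1 := IH n (S k) ltac:(lia)); assert (H2 := IH (S n) k ltac:(lia)).
    apply (Nat.mul_le_mono_l _ _ (S n)) in H1; apply (Nat.mul_le_mono_l _ _ (S k)) in H2.
    rewrite (fact_simpl m); replace (S m) with (S n + S k)%nat at 1 by lia.
    rewrite Nat.mul_add_distr_r, Nat.pow_succ_r'.
    replace (2 * 2 ^ m * (fact (S n) * fact (S k)))%nat with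
      (S n * (2 ^ m * (fact n * fact (S k))) + S k * (2 ^ m * (fact (S n) * fact k)))%nat
      by (rewrite !fact_simpl; ring).
    lia.
Qed.

Lemma exp_sub_T (N : nat) (x : R) : (1 <= N)%nat ->
  exp x - T (N - 1) x = x ^ N * PSeries (PS_decr_n (fun n => / INR (fact n)) N) x.
Proof.
intros HN.
assert (E := PSeries_decr_n (fun n => / INR (fact n)) (N - 1) x
               (ex_intro _ _ (is_exp_Reals x))).
rewrite (is_pseries_unique _ _ _ (is_exp_Reals x)) in E.
replace (S (N - 1)) with N in E by lia.
rewrite E; unfold T.
rewrite (sum_eq _ (fun k => x ^ k / INR (fact k)))
  by (intros; unfold Rdiv; ring).
ring.
Qed.

(** Termwise, [1 / (N + k)! >= 1 / (2^N N!) * 1 / (2^k k!)], and the factor [2^k] turns [x] into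
    [x / 2] in the exponential series. *)
Lemma exp_sub_T_ge (N : nat) (x : R) : (1 <= N)%nat -> 0 < x ->
  x ^ N * (/ (2 ^ N * INR (fact N)) * exp (x / 2)) <= exp x - T (N - 1) x.
Proof.
intros HN Hx; rewrite exp_sub_T by exact HN.
apply Rmult_le_compat_l; [apply pow_le; lra|].
rewrite <- (is_pseries_unique _ _ _ (is_exp_Reals (x / 2))), <- PSeries_scal.
assert (Hf : forall k, 0 < INR (fact k)) by (intros; apply INR_fact_lt_0).
assert (H2 : forall k, 0 < 2 ^ k) by (intros; apply pow_lt; lra).
unfold PSeries; apply Series_le.
- intros k; unfold PS_scal, PS_decr_n; change scal with Rmult; cbv beta.
  assert (Hx2 : 0 < (x / 2) ^ k) by (apply pow_lt; lra).
  split.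
  + apply Rlt_le; repeat apply Rmult_lt_0_compat; auto;
    apply Rinv_0_lt_compat; auto using Rmult_lt_0_compat.
  + replace (x ^ k) with (2 ^ k * (x / 2) ^ k)
      by (rewrite <- Rpow_mult_distr; f_equal; field).
    rewrite <- Rmult_assoc; apply Rmult_le_compat_r; [lra|].
    assert (H := le_INR _ _ (fact_add_le N k)).
    rewrite !mult_INR, pow_INR, pow_add in H.
    change (INR 2) with 2 in H.
    assert (Ha := H2 N); assert (Hb := H2 k).
    assert (Fa := Hf N); assert (Fb := Hf k); assert (Fc := Hf (N + k)%nat).
    apply Rmult_le_reg_r with (2 ^ N * INR (fact N) * INR (fact k) * INR (fact (N + k))).
    { repeat apply Rmult_lt_0_compat; assumption. }
    replace (/ (2 ^ N * INR (fact N)) * / INR (fact k) * (2 ^ N * INR (fact N) * INR (fact k) * INR (fact (N + k))))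
      with (INR (fact (N + k))) by (field; repeat split; lra).
    replace (/ INR (fact (N + k)) * 2 ^ k * (2 ^ N * INR (fact N) * INR (fact k) * INR (fact (N + k))))
      with (2 ^ N * 2 ^ k * (INR (fact N) * INR (fact k))) by (field; repeat split; lra).
    exact H.
- assert (E := ex_pseries_decr_n (fun n => / INR (fact n)) N x).
  apply ex_pseries_R, E; [|eexists; apply is_exp_Reals].
  right; exists (/ x); change (/ x * x = 1); field; lra.
Qed.

Definition gen_fun (N : nat) (x : R) : R := x ^ N / INR (fact N) / (exp x - T (N - 1) x).

Lemma exp_sub_T_pos (N : nat) (x : R) : (1 <= N)%nat -> 0 < x -> 0 < exp x - T (N - 1) x.
Proof.
intros HN Hx; apply Rlt_le_trans with (2 := exp_sub_T_ge N x HN Hx).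
repeat apply Rmult_lt_0_compat; [apply pow_lt, Hx| |apply exp_pos].
apply Rinv_0_lt_compat, Rmult_lt_0_compat; [apply pow_lt; lra|apply INR_fact_lt_0].
Qed.

Lemma ex_derive_T (m : nat) (x : R) : ex_derive (T m) x.
Proof.
induction m as [|m IH].
- apply (ex_derive_ext (K := R_AbsRing) (V := R_NormedModule) (fun _ => 1)).
  + intros t; unfold T; simpl; field.
  + apply ex_derive_const.
- apply (ex_derive_plus (K := R_AbsRing) (V := R_NormedModule) (T m) (fun x => x ^ S m / INR (fact (S m)))).
  + exact IH.
  + auto_derive; exact I.
Qed.

Lemma exp_decay_gen_fun (N : nat) : (1 <= N)%nat -> exp_decay (gen_fun N).
Proof.
intros HN; split.
- intros x Hx; assert (Hp := exp_sub_T_pos N x HN Hx).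
  apply (ex_derive_continuous (K := R_AbsRing) (V := R_NormedModule)).
  assert (HT := ex_derive_T (N - 1) x).
  unfold gen_fun; set (g := T (N - 1)) in *; clearbody g.
  auto_derive; repeat split; try lra; exact HT.
- exists (2 ^ N); split; [apply pow_lt; lra|]; intros x Hx.
  assert (Hp := exp_sub_T_pos N x HN Hx); assert (Hge := exp_sub_T_ge N x HN Hx).
  assert (Hf := INR_fact_lt_0 N); assert (HxN := pow_lt x N Hx); assert (H2 := pow_lt 2 N Rlt_0_2).
  unfold gen_fun; rewrite Rabs_pos_eq by (apply Rlt_le; repeat apply Rdiv_lt_0_compat; lra).
  apply Rmult_le_reg_r with (1 := Hp).
  unfold Rdiv at 1; rewrite Rmult_assoc, Rinv_l, Rmult_1_r by lra.
  apply Rle_trans with (2 ^ N * exp (- x / 2) * (x ^ N * (/ (2 ^ N * INR (fact N)) * exp (x / 2)))).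
  + right; replace (- x / 2) with (- (x / 2)) by field; rewrite exp_Ropp.
    field; repeat split; try lra; apply Rgt_not_eq, exp_pos.
  + apply Rmult_le_compat_l; [|exact Hge].
    apply Rmult_le_pos; [lra|apply Rlt_le, exp_pos].
Qed.

Definition exp_coef (n : nat) : R := / INR (fact n).
Definition exp_opp_coef (n : nat) : R := (-1) ^ n / INR (fact n).

Lemma is_pseries_exp_opp (x : R) : is_pseries exp_opp_coef x (exp (- x)).
Proof.
apply is_pseries_R; generalize (proj1 (is_pseries_R _ _ _) (is_exp_Reals (- x))).
apply is_series_ext; intros n; unfold exp_opp_coef.
match goal with |- ?a = ?b => change (@eq R a b) end.
replace (- x) with (-1 * x) by ring; rewrite Rpow_mult_distr; unfold Rdiv; ring.
Qed.

Lemma CV_radius_infinite_of (a : nat -> R) :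
  (forall x, ex_pseries a x) -> forall x, Rbar_lt (Rabs x) (CV_radius a).
Proof.
intros H x; apply (CV_radius_ge a (Rabs x + 1)).
- generalize (Rabs_pos x); lra.
- intros y _; apply H.
- lra.
Qed.

Lemma CV_exp_coef (x : R) : Rbar_lt (Rabs x) (CV_radius exp_coef).
Proof. apply CV_radius_infinite_of; intros y; eexists; apply is_exp_Reals. Qed.

Lemma CV_exp_opp_coef (x : R) : Rbar_lt (Rabs x) (CV_radius exp_opp_coef).
Proof. apply CV_radius_infinite_of; intros y; eexists; apply is_pseries_exp_opp. Qed.

(** The sums agree near 0 because [exp x * exp (- x) = 1], and a power series determines its
    coefficients. *)
Lemma PS_mult_expK (b : nat -> R) (r : R) : 0 < r ->
  (forall x, Rabs x < r -> Rbar_lt (Rabs x) (CV_radius b)) ->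
  forall n, PS_mult (PS_mult b exp_coef) exp_opp_coef n = b n.
Proof.
intros Hr Hb.
assert (Hm : forall x, Rabs x < r ->
  is_pseries (PS_mult b exp_coef) x (PSeries b x * exp x)).
{ intros x Hx; apply is_pseries_mult; [|apply is_exp_Reals|apply Hb, Hx|apply CV_exp_coef].
  apply PSeries_correct, CV_radius_inside, Hb, Hx. }
assert (Hd : forall x, Rabs x < r -> Rbar_lt (Rabs x) (CV_radius (PS_mult b exp_coef))).
{ apply CV_radius_ge; [exact Hr|]; intros x Hx.
  eexists; apply Hm; rewrite Rabs_pos_eq; lra. }
assert (Hmm : forall x, Rabs x < r ->
  is_pseries (PS_mult (PS_mult b exp_coef) exp_opp_coef) x (PSeries b x * exp x * exp (- x))).
{ intros x Hx; apply is_pseries_mult;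
    [apply Hm, Hx|apply is_pseries_exp_opp|apply Hd, Hx|apply CV_exp_opp_coef]. }
intros n; apply PSeries_ext_recip.
- apply Rbar_lt_trans with (y := Finite (r / 2)); [simpl; lra|].
  rewrite <- (Rabs_pos_eq (r / 2)) by lra; apply (CV_radius_ge _ r Hr).
  + intros x Hx; eexists; apply Hmm; rewrite Rabs_pos_eq; lra.
  + rewrite Rabs_pos_eq; lra.
- apply Rbar_lt_trans with (y := Finite (r / 2)); [simpl; lra|].
  rewrite <- (Rabs_pos_eq (r / 2)) by lra; apply Hb; rewrite Rabs_pos_eq; lra.
- exists (mkposreal _ Hr); intros x Hx; change (Rabs (x - 0) < r) in Hx.
  rewrite Rminus_0_r in Hx.
  rewrite (is_pseries_unique _ _ _ (Hmm x Hx)), Rmult_assoc, <- exp_plus, Rplus_opp_r, exp_0; ring.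
Qed.

Lemma Cpoch_neg (m j : nat) : (j <= m)%nat ->
  Cpoch (- RtoC (INR m)) j = RtoC ((-1) ^ j * (INR (fact m) / INR (fact (m - j)))).
Proof.
induction j as [|j IH]; intros Hj.
- cbn [Cpoch]; rewrite Nat.sub_0_r; f_equal; simpl pow; field; apply INR_fact_neq_0.
- cbn [Cpoch]; rewrite IH by lia.
  replace (m - j)%nat with (S (m - S j)) by lia.
  rewrite fact_simpl, mult_INR; replace (INR (S (m - S j))) with (INR m - INR j)
    by (rewrite <- minus_INR by lia; f_equal; lia).
  assert (H := lt_INR j m ltac:(lia)); assert (Hf := INR_fact_neq_0 (m - S j)).
  rewrite <- RtoC_opp, <- RtoC_plus, <- RtoC_mult; f_equal; simpl pow; field; split; [exact Hf|lra].
Qed.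

(** Since [(- m)_j = (-1)^m m! * (-1)^{m-j} / (m - j)!], the sum is a Cauchy product with the series
    of [exp (- x)]. *)
Lemma poch_sum_neg (d : nat -> R) (m : nat) :
  poch_sum d (- RtoC (INR m)) (S m) =
  RtoC ((-1) ^ m * INR (fact m) * PS_mult d exp_opp_coef m).
Proof.
assert (H : forall k, (k <= m)%nat -> poch_sum d (- RtoC (INR m)) (S k) =
  RtoC (sum_f_R0 (fun j => (-1) ^ m * INR (fact m) * (d j * exp_opp_coef (m - j))) k)).
{ assert (E : forall j, (j <= m)%nat -> (RtoC (d j) * Cpoch (- RtoC (INR m)) j)%C =
    RtoC ((-1) ^ m * INR (fact m) * (d j * exp_opp_coef (m - j)))).
  { intros j Hj; rewrite Cpoch_neg by exact Hj; rewrite <- RtoC_mult; f_equal.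
    unfold exp_opp_coef.
    assert (E : (-1) ^ j = (-1) ^ m * (-1) ^ (m - j)).
    { replace m with (m - j + j)%nat at 1 by lia; rewrite pow_add.
      assert (H1 : ((-1) ^ (m - j)) * ((-1) ^ (m - j)) = 1)
        by (rewrite <- Rpow_mult_distr; replace (-1 * -1) with 1 by ring; apply pow1).
      transitivity ((-1) ^ j * ((-1) ^ (m - j) * (-1) ^ (m - j))); [rewrite H1|]; ring. }
    rewrite E; field; apply INR_fact_neq_0. }
  induction k as [|k IH]; intros Hk.
  - cbn [poch_sum]; rewrite E by lia; cbn [sum_f_R0]; ring.
  - change (poch_sum d (- RtoC (INR m)) (S (S k))) with
      (poch_sum d (- RtoC (INR m)) (S k) + RtoC (d (S k)) * Cpoch (- RtoC (INR m)) (S k))%C.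
    rewrite IH, E, <- RtoC_plus by lia; reflexivity. }
rewrite H by lia; f_equal; unfold PS_mult.
rewrite scal_sum; apply sum_eq; intros; ring.
Qed.

Lemma mellin_ratio_gen_fun_neg (N : nat) (B : nat -> R) : (1 <= N)%nat -> is_gen_bernoulli N B ->
  exists d, exp_series_at_0 (gen_fun N) d /\
    forall m, mellin_ratio (gen_fun N) d (- RtoC (INR m)) = RtoC ((-1) ^ m * B m).
Proof.
intros HN [r [Hr HB]]; set (b := fun m => B m / INR (fact m)) in *.
assert (Hb : forall x, Rabs x < r -> Rbar_lt (Rabs x) (CV_radius b)).
{ apply CV_radius_ge; [exact Hr|]; intros x Hx.
  eexists; apply HB; rewrite Rabs_pos_eq; lra. }
set (d := PS_mult b exp_coef).
assert (Hd : exp_series_at_0 (gen_fun N) d).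
{ exists r; split; [exact Hr|]; intros x Hx.
  assert (Hx1 : 0 < Rabs x < r) by (rewrite Rabs_pos_eq; lra).
  apply is_pseries_mult;
    [apply HB, Hx1|apply is_exp_Reals|apply Hb, Hx1|apply CV_exp_coef]. }
exists d; split; [exact Hd|]; intros m.
rewrite mellin_ratio_neg; [|apply exp_decay_gen_fun, HN|exact Hd].
rewrite poch_sum_neg; f_equal; unfold d; rewrite (PS_mult_expK b r Hr Hb).
unfold b; field; apply INR_fact_neq_0.
Qed.

(** * Valuations of factorial quotients *)

Module PrimePower.
Import all_boot zify.
Local Open Scope nat_scope.
Local Set Implicit Arguments.
Local Unset Strict Implicit.

Lemma exists_seq_max (s : seq nat) (f : nat -> nat) : s != [::] ->
  exists2 x, x \in s & forall y, y \in s -> f y <= f x.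
Proof.
elim: s => // a s IH _; case: (eqVneq s [::]) => [->|/IH [x xs Hx]].
  by exists a => [|y]; rewrite inE // => /eqP ->.
have [le|lt] := leqP (f x) (f a).
- exists a; first by rewrite inE eqxx.
  move=> y; rewrite inE => /orP [/eqP -> //|/Hx H]; exact: leq_trans H le.
- exists x; first by rewrite inE xs orbT.
  move=> y; rewrite inE => /orP [/eqP ->|/Hx //]; exact: ltnW.
Qed.

(** The factor 2 is what allows [k] to range up to [2 * c] in [block_room]. *)
Lemma fact_double_le (m : nat) : 0 < m -> 2 * m`! <= m.+1 ^ m.
Proof.
elim: m => // [[|m]] IH _ //.
rewrite factS mulnCA expnS; apply: leq_mul => //.
by apply: leq_trans (IH isT) _; rewrite leq_exp2r.
Qed.

(** A prime power not exceeding [m] is itself a factor of the factorial, and the prime powers of [c]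
    are pairwise coprime. *)
Lemma dvdn_fact_of_prime_powers (c m : nat) : 0 < c ->
  (forall q, prime q -> q %| c -> q ^ logn q c <= m) -> c %| m`!.
Proof.
move=> c0 H; apply/dvdn_partP => // q; rewrite mem_primes => /and3P [pq _ qc].
by rewrite p_part; apply: dvdn_fact; rewrite expn_gt0 prime_gt0 //= H.
Qed.

Lemma logn_addn_lt (p e n j : nat) : prime p -> 0 < j -> p ^ e %| n -> ~~ (p ^ e %| j) ->
  logn p (n + j) = logn p j.
Proof.
move=> pp j0 en ej.
have nj0 : 0 < n + j by rewrite addn_gt0 j0 orbT.
have lt1 : logn p j < e by rewrite ltnNge -pfactor_dvdn.
have lt2 : logn p (n + j) < e by rewrite ltnNge -pfactor_dvdn // dvdn_addr.
have H k : k < e -> (k <= logn p (n + j)) = (k <= logn p j).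
  move=> ke; rewrite -!pfactor_dvdn // dvdn_addr //.
  by apply: dvdn_trans en; apply: dvdn_exp2l; apply: ltnW.
by apply/eqP; rewrite eqn_leq -(H _ lt2) (H _ lt1) !leqnn.
Qed.

Definition logn_sum (p n L : nat) := \sum_(j < L) logn p (n + j.+1).

Lemma logn_sumS (p n L : nat) :
  logn_sum p n L.+1 = logn_sum p n L + logn p (n + L.+1).
Proof. by rewrite /logn_sum big_ord_recr. Qed.

Lemma logn_fact_add (p n L : nat) : logn p (n + L)`! = logn p n`! + logn_sum p n L.
Proof.
elim: L => [|L IH]; first by rewrite /logn_sum big_ord0 !addn0.
by rewrite addnS factS lognM ?fact_gt0 // IH logn_sumS addnS addnC addnA.
Qed.

Section Blocks.
Variables (p n c e : nat).
Hypotheses (pp : prime p) (e0 : 0 < e) (c0 : 0 < c) (En : n = p ^ e * c) (pc : ~~ (p %| c)).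
Hypothesis Hmax : forall q, prime q -> q %| n -> q ^ logn q n <= p ^ e.
Let Q := p ^ e.

Let Q2 : 1 < Q.
Proof. by rewrite -(expn0 p) ltn_exp2l // prime_gt1. Qed.

(* The terms strictly between two multiples of [Q] leave enough room to pay for the
   extra valuation [logn p k] at the next multiple: [c * p ^ logn p (Q.-1)`!] divides
   [(Q.-1)`!], since all prime powers in [c] are less than [Q]. *)
Lemma block_room (k : nat) : k < 2 * c -> 0 < k ->
  logn p (Q.-1)`! + logn p k < e * Q.-1.
Proof.
move=> kc k0; set W := logn p _.
have Qm : 0 < Q.-1 by rewrite -ltnS prednK // ltnW.
have cop : coprime c (p ^ W) by rewrite coprimeXr // coprime_sym prime_coprime.
have c_dvd : c %| (Q.-1)`!.
  apply: dvdn_fact_of_prime_powers => // q pq qc.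
  have qp : q != p by apply: contra pc => /eqP <-.
  have lq : logn q n = logn q c.
    rewrite En lognM ?expn_gt0 ?(prime_gt0 pp) // lognX.
    by rewrite logn_prime // (negbTE qp) muln0.
  have le : q ^ logn q c <= Q.
    by rewrite -lq; apply: Hmax => //; rewrite En dvdn_mull.
  rewrite -ltnS prednK ?(ltnW Q2) // ltn_neqAle le andbT.
  apply/negP => /eqP E.
  have : p %| q ^ logn q c by rewrite E /Q -(prednK e0) expnS dvdn_mulr.
  rewrite Euclid_dvdX // => /andP [pq' _].
  by move: pq'; rewrite dvdn_prime2 // eq_sym (negbTE qp).
have W_dvd : p ^ W %| (Q.-1)`! by rewrite pfactor_dvdn // fact_gt0.
have le1 : c * p ^ W <= (Q.-1)`!.
  by apply: dvdn_leq; rewrite ?fact_gt0 // Gauss_dvd // c_dvd.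
have le2 := @fact_double_le _ Qm; rewrite prednK ?(ltnW Q2) // in le2.
(* Here [p ^ logn p k <= k < 2 * c], so the left side is less than [2 * c * p ^ W]. This is at most
   twice the factorial of [Q.-1], hence at most [Q ^ Q.-1]. *)
have lt3 : p ^ (W + logn p k) < p ^ (e * Q.-1).
  rewrite expnD expnM -/Q; apply: leq_trans le2.
  apply: leq_trans (_ : p ^ W * (2 * c) <= _); last first.
    by rewrite mulnCA leq_mul2l [p ^ W * c]mulnC le1.
  rewrite ltn_pmul2l ?expn_gt0 ?prime_gt0 //.
  by apply: leq_ltn_trans kc; apply: dvdn_leq => //; apply: pfactor_dvdnn.
by rewrite -(ltn_exp2l _ _ (prime_gt1 pp)).
Qed.

Lemma logn_block (a r : nat) : 0 < r < Q -> logn p (n + (a * Q + r)) = logn p r.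
Proof.
case/andP=> r0 rQ; rewrite addnA; apply: (@logn_addn_lt _ e) => //.
  by apply: dvdn_add; [rewrite En dvdn_mulr|rewrite dvdn_mull].
by rewrite gtnNdvd.
Qed.

Lemma logn_small (r : nat) : 0 < r < Q -> logn p r < e.
Proof.
case/andP=> r0 rQ; rewrite -(ltn_exp2l _ _ (prime_gt1 pp)).
by apply: leq_ltn_trans rQ; apply: dvdn_leq => //; apply: pfactor_dvdnn.
Qed.

Lemma logn_sum_block (a r : nat) : r < Q ->
  logn_sum p n (a * Q + r) = logn_sum p n (a * Q) + logn p r`!.
Proof.
elim: r => [|r IH] rQ; first by rewrite !addn0 logn1 addn0.
rewrite addnS logn_sumS -addnS logn_block // IH ?(ltnW rQ) //.
by rewrite factS lognM ?fact_gt0 // -addnA [logn p r`! + _]addnC.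
Qed.

(** Every factor below [Q] has valuation at most [e - 1], a saving of one per factor. *)
Lemma logn_fact_le (r : nat) : r < Q -> logn p r`! + r <= r * e.
Proof.
elim: r => [|r IH] rQ; first by rewrite logn1.
rewrite factS lognM ?fact_gt0 //.
have := IH (ltnW rQ); have := @logn_small r.+1 rQ; rewrite mulSn; lia.
Qed.

(** In a block of [Q] consecutive factors the non-multiples of [Q] contribute the valuation of the
    factorial of [Q.-1], and the last factor [Q * (c + a.+1)] contributes [e + logn p (c + a.+1)].
    By [block_room] the total is less than [Q * e], a saving of one per block. *)
Lemma logn_sum_blocks (a : nat) : a < c -> logn_sum p n (a * Q) + a <= a * Q * e.
Proof.
elim: a => [|a IH] ac; first by rewrite /logn_sum big_ord0.
have E : a.+1 * Q = (a * Q + Q.-1).+1 by rewrite mulSn -addnS prednK ?(ltnW Q2) // addnC.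
rewrite {1}E logn_sumS logn_sum_block ?prednK ?(ltnW Q2) // -E.
have -> : logn p (n + a.+1 * Q) = e + logn p (c + a.+1).
  rewrite En mulnC -/Q -mulnDl lognM ?addn_gt0 ?c0 ?(ltnW Q2) // addnC.
  by rewrite /Q lognX logn_prime // eqxx muln1.
have room : logn p (Q.-1)`! + logn p (c + a.+1) < e * Q.-1.
  by apply: block_room; rewrite ?addn_gt0 ?c0 // mul2n -addnn ltn_add2l.
have := IH (ltnW ac).
have -> : a.+1 * Q * e = a * Q * e + e * Q.-1 + e.
  rewrite E -addnS prednK ?(ltnW Q2) // mulnDl -addnA; congr (_ + _).
  by rewrite -{1}(prednK (ltnW Q2)) mulSn addnC [e * _]mulnC.
lia.
Qed.

(** Each full block and each factor of the incomplete block saves at least one, and [0 < L] provides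
    at least one of these. *)
Lemma logn_sum_lt (L : nat) : 0 < L -> L < n -> logn_sum p n L < L * e.
Proof.
move=> L0 Ln.
have ac : L %/ Q < c by rewrite ltn_divLR ?(ltnW Q2) // mulnC -En.
have rQ : L %% Q < Q by rewrite ltn_mod (ltnW Q2).
have H1 := logn_sum_blocks ac; have H2 := logn_fact_le rQ.
rewrite (divn_eq L Q) logn_sum_block // mulnDl.
have : 0 < L %/ Q + L %% Q.
  rewrite lt0n addn_eq0; apply/negP => /andP [/eqP E1 /eqP E2].
  by move: L0; rewrite (divn_eq L Q) E1 E2.
lia.
Qed.

End Blocks.

(** A division-free way to say that [n^L / ((n + 1) ... (n + L))] is [p] times a fraction whose
    denominator [u] is prime to [p]. *)
Lemma pow_fact_quotient (n : nat) : 1 < n -> exists2 p, prime p &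
  forall L, 0 < L -> L < n -> exists u w,
    ~~ (p %| u) /\ n ^ L * u * n`! = p * w * (n + L)`!.
Proof.
move=> n1; have n0 := ltnW n1.
have : primes n != [::].
  have : pdiv n \in primes n by rewrite mem_primes pdiv_prime // n0 pdiv_dvd.
  by case: (primes n).
case/(exists_seq_max (fun q => q ^ logn q n)) => p.
rewrite mem_primes => /and3P [pp _ pn] Hp; exists p => // L L0 Ln.
set e := logn p n; set c := n`_p^'.
have En : n = p ^ e * c by rewrite -p_part partnC.
have pc : ~~ (p %| c).
  by rewrite -p'natE // part_pnat.
have e0 : 0 < e by rewrite logn_gt0 mem_primes pp n0.
have H : logn_sum p n L < L * e.
  apply: (logn_sum_lt pp e0 (part_gt0 _ _) En pc _ L0 Ln) => q pq qn.
  by apply: Hp; rewrite mem_primes pq n0.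
set P := \prod_(j < L) (n + j.+1).
have P0 : 0 < P by apply: prodn_gt0 => j; rewrite addn_gt0 n0.
have PE : (n + L)`! = n`! * P.
  rewrite /P; elim: (L) => [|k IH]; first by rewrite big_ord0 addn0 muln1.
  by rewrite big_ord_recr /= !addnS factS IH mulnC mulnA.
have lP : logn p P < L * e.
  have := logn_fact_add p n L; rewrite PE lognM ?fact_gt0 // => /addnI -> //.
(* [u] is the prime-to-[p] part of the product [P]. Of the [L * e] factors [p] in [n ^ L],
   [logn p P] complete [u] to [P], one is displayed, and the others go into [w]. *)
exists P`_p^'; exists (p ^ (L * e - (logn p P).+1) * c ^ L); split.
  by rewrite -p'natE // part_pnat.
have E2 := partnC p P0; rewrite p_part in E2.
have -> : n ^ L = p ^ (logn p P).+1 * p ^ (L * e - (logn p P).+1) * c ^ L.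
  by rewrite -expnD subnKC // {1}En expnMn -expnM [e * L]mulnC.
rewrite PE expnS; move: (p ^ (L * e - _)) (p ^ logn p P) (P`_p^') E2 => x y z <-.
by rewrite -!mulnA; congr (_ * _); rewrite mulnCA; congr (_ * _);
   rewrite mulnCA; congr (_ * _); rewrite [in RHS]mulnCA; congr (_ * _); rewrite mulnC.
Qed.

Lemma factorialE (n : nat) : n`! = Factorial.fact n.
Proof. by elim: n => //= n IH; rewrite factS IH /= mulSn. Qed.

Lemma expnE (n k : nat) : n ^ k = Nat.pow n k.
Proof. by elim: k => //= k IH; rewrite expnS IH. Qed.

Lemma divideE (d n : nat) : Nat.divide d n <-> d %| n.
Proof. by split => [|/dvdnP] [k ->]; [exact: dvdn_mull|exists k]. Qed.

(** The interface to the real-number part: standard library operations, and primality in the form of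
    the two properties that the localization uses. *)
Lemma pow_fact_quotient_nat (n : nat) : Peano.lt 1 n ->
  exists p, ~ Nat.divide p 1 /\
    (forall a b, Nat.divide p (Nat.mul a b) -> Nat.divide p a \/ Nat.divide p b) /\
    forall L, Peano.lt 0 L -> Peano.lt L n -> exists u w, ~ Nat.divide p u /\
      Nat.mul (Nat.mul (Nat.pow n L) u) (Factorial.fact n) =
      Nat.mul (Nat.mul p w) (Factorial.fact (Nat.add n L)).
Proof.
move=> /ltP n1; case: (pow_fact_quotient n1) => p pp H; exists p; split; [|split].
- by rewrite divideE dvdn1; case: eqP pp => // ->.
- move=> a b; rewrite !divideE multE Euclid_dvdM // => /orP.
  by case; [left|right].
- move=> L /ltP L0 /ltP Ln; case: (H L L0 Ln) => u [w [pu E]]; exists u; exists w.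
  split; first by rewrite divideE; apply/negP.
  by rewrite -!factorialE -expnE.
Qed.

End PrimePower.

(** * Nonvanishing of the first Bernoulli numbers *)

(** The Taylor coefficients at 0 of [N! (e^x - T_{N-1}(x)) / x^N], the reciprocal of the generating
    function. *)
Definition tail_coef (N k : nat) : R := INR (fact N) / INR (fact (N + k)).

(** These are the coefficients of the product of the generating function with its reciprocal. *)
Lemma gen_bernoulli_rec (N : nat) (B : nat -> R) : (1 <= N)%nat -> is_gen_bernoulli N B ->
  forall m, sum_f_R0 (fun j => B j / INR (fact j) * tail_coef N (m - j)) m =
    match m with O => 1 | S _ => 0 end.
Proof.
intros HN [r [Hr HB]] m; set (b := fun m => B m / INR (fact m)) in *.
set (one_coef := fun m : nat => match m with O => 1 | S _ => 0 end).
assert (Hb : forall x, Rabs x < r -> Rbar_lt (Rabs x) (CV_radius b)).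
{ apply CV_radius_ge; [exact Hr|]; intros x Hx.
  eexists; apply HB; rewrite Rabs_pos_eq; lra. }
assert (Ha : forall x, is_pseries (PS_decr_n exp_coef N) x (PSeries (PS_decr_n exp_coef N) x)).
{ intros x; apply PSeries_correct, ex_pseries_decr_n; [|eexists; apply is_exp_Reals].
  destruct (Req_dec x 0) as [H0|H0]; [left; exact H0|].
  right; exists (/ x); change (/ x * x = 1); field; exact H0. }
assert (Hnz : locally 0 (fun x => PSeries (PS_decr_n exp_coef N) x <> 0)).
{ assert (HC : continuous (PSeries (PS_decr_n exp_coef N)) 0).
  { apply continuity_pt_filterlim, PSeries_continuity, CV_radius_infinite_of.
    intros y; eexists; apply Ha. }
  apply (HC (fun y => y <> 0)); rewrite PSeries_0.
  assert (H0 : 0 < PS_decr_n exp_coef N 0) by apply Rinv_0_lt_compat, INR_fact_lt_0.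
  exists (mkposreal _ H0); intros y Hy ->.
  change (Rabs (0 - PS_decr_n exp_coef N 0) < PS_decr_n exp_coef N 0) in Hy.
  apply Rabs_def2 in Hy; lra. }
assert (Hm : forall x, Rabs x < r -> is_pseries (PS_mult b (tail_coef N)) x
   (PSeries b x * (INR (fact N) * PSeries (PS_decr_n exp_coef N) x))).
{ intros x Hx; apply is_pseries_mult; [| |apply Hb, Hx|].
  - apply PSeries_correct, CV_radius_inside, Hb, Hx.
  - generalize (is_pseries_scal (INR (fact N)) _ x _ (Rmult_comm _ _) (Ha x)).
    apply is_pseries_ext; intros n; reflexivity.
  - revert x Hx; intros x _.
    apply (CV_radius_infinite_of (tail_coef N)); intros y; eexists.
    generalize (is_pseries_scal (INR (fact N)) _ y _ (Rmult_comm _ _) (Ha y)).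
    apply is_pseries_ext; intros n; reflexivity. }
assert (Hone : forall x, is_pseries one_coef x 1).
{ intros x; apply is_pseries_R.
  apply filterlim_ext with (fun _ => 1); [|apply filterlim_const].
  intros n; rewrite sum_n_Reals; induction n as [|n IH]; simpl.
  - ring.
  - rewrite <- IH; ring. }
change (PS_mult b (tail_coef N) m = one_coef m).
change (PS_incr_1 (PS_mult b (tail_coef N)) (S m) = PS_incr_1 one_coef (S m)).
(* After multiplication by [x] the two series also agree at [x = 0], where the
   generating function is undefined. *)
apply PSeries_ext_recip.
- rewrite CV_radius_incr_1.
  apply Rbar_lt_trans with (y := Finite (r / 2)); [simpl; lra|].
  rewrite <- (Rabs_pos_eq (r / 2)) by lra; apply (CV_radius_ge _ r Hr).
  + intros x Hx; eexists; apply Hm; rewrite Rabs_pos_eq; lra.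
  + rewrite Rabs_pos_eq; lra.
- rewrite CV_radius_incr_1.
  apply Rbar_lt_trans with (y := Finite 1); [simpl; lra|].
  rewrite <- Rabs_R1; apply CV_radius_infinite_of; intros y; eexists; apply Hone.
- assert (Hlr : locally 0 (fun x => Rabs (x - 0) < r)) by (exists (mkposreal _ Hr); auto).
  generalize (filter_and (F := locally 0) _ _ Hnz Hlr).
  apply (filter_imp (F := locally 0)); intros x [Hx2 Hx]; change (Rabs (x - 0) < r) in Hx.
  rewrite Rminus_0_r in Hx.
  rewrite !PSeries_incr_1, (is_pseries_unique _ _ _ (Hone x)).
  destruct (Req_dec x 0) as [->|Hx0]; [ring|].
  rewrite (is_pseries_unique _ _ _ (Hm x Hx)).
  assert (Hx1 : 0 < Rabs x < r) by (split; [apply Rabs_pos_lt, Hx0|exact Hx]).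
  rewrite (is_pseries_unique _ _ _ (HB x Hx1)), exp_sub_T by exact HN.
  assert (HxN : x ^ N <> 0) by (apply pow_nonzero, Hx0).
  assert (HfN := INR_fact_neq_0 N).
  change (fun n => / INR (fact n)) with exp_coef.
  field; auto.
Qed.

(* For [p] prime: [x] lies in [q * Z_(p)], where [Z_(p)] is the ring of
   fractions with denominator prime to [p]. *)
Definition in_local_ideal (p : nat) (q : Z) (x : R) : Prop :=
  exists (a : Z) (u : nat), ~ Nat.divide p u /\ x * INR u = IZR (q * a).

Section LocalIdeal.
Variable p : nat.
Hypothesis p_not_unit : ~ Nat.divide p 1.
Hypothesis p_euclid : forall a b, Nat.divide p (a * b) -> Nat.divide p a \/ Nat.divide p b.

Lemma in_local_ideal_IZR (q a : Z) : in_local_ideal p q (IZR (q * a)).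
Proof. exists a, 1%nat; split; [exact p_not_unit|simpl; ring]. Qed.

Lemma in_local_ideal_plus (q : Z) (x y : R) :
  in_local_ideal p q x -> in_local_ideal p q y -> in_local_ideal p q (x + y).
Proof.
intros [a [u [Hu Ex]]] [b [v [Hv Ey]]].
exists (a * Z.of_nat v + b * Z.of_nat u)%Z, (u * v)%nat; split.
- intros H; destruct (p_euclid _ _ H); contradiction.
- replace (q * (a * Z.of_nat v + b * Z.of_nat u))%Z
    with (q * a * Z.of_nat v + q * b * Z.of_nat u)%Z by ring.
  rewrite plus_IZR, (mult_IZR (q * a)), (mult_IZR (q * b)), <- Ex, <- Ey, <- !INR_IZR_INZ, mult_INR.
  ring.
Qed.

Lemma in_local_ideal_mult (q : Z) (x y : R) :
  in_local_ideal p 1 x -> in_local_ideal p q y -> in_local_ideal p q (x * y).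
Proof.
intros [a [u [Hu Ex]]] [b [v [Hv Ey]]].
exists (a * b)%Z, (u * v)%nat; split.
- intros H; destruct (p_euclid _ _ H); contradiction.
- rewrite mult_INR; replace (q * (a * b))%Z with ((1 * a) * (q * b))%Z by ring.
  rewrite mult_IZR, <- Ex, <- Ey; ring.
Qed.

Lemma in_local_ideal_opp (q : Z) (x : R) : in_local_ideal p q x -> in_local_ideal p q (- x).
Proof.
intros [a [u [Hu Ex]]]; exists (- a)%Z, u; split; [exact Hu|].
replace (q * - a)%Z with (- (q * a))%Z by ring; rewrite opp_IZR, <- Ex; ring.
Qed.

Lemma in_local_ideal_weaken (x : R) : in_local_ideal p (Z.of_nat p) x -> in_local_ideal p 1 x.
Proof.
intros [a [u [Hu Ex]]]; exists (Z.of_nat p * a)%Z, u; split; [exact Hu|].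
rewrite Ex; f_equal; ring.
Qed.

Lemma pow_opp1_IZR (m : nat) : exists s : Z, (s = 1 \/ s = -1)%Z /\ (-1) ^ m = IZR s.
Proof.
induction m as [|m [s [Hs E]]]; [exists 1%Z; split; [left|]; reflexivity|].
exists (- s)%Z; split; [lia|]; rewrite opp_IZR, <- E; simpl; ring.
Qed.

(** Powers of -1 are units of the local ring: [s * u = p * a] with [s] equal to 1 or -1 would make
    [p] divide [u]. *)
Lemma pow_opp1_notin (m : nat) : ~ in_local_ideal p (Z.of_nat p) ((-1) ^ m).
Proof.
intros [a [u [Hu E]]]; destruct (pow_opp1_IZR m) as [s [Hs Es]].
rewrite Es, INR_IZR_INZ, <- mult_IZR in E; apply eq_IZR in E.
apply Hu; exists (Z.to_nat (Z.abs a)).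
apply Nat2Z.inj; rewrite Nat2Z.inj_mul, Z2Nat.id by lia.
assert (Ea : Z.of_nat u = (s * (Z.of_nat p * a))%Z) by nia.
destruct Hs as [-> | ->]; nia.
Qed.

End LocalIdeal.

(** Modulo [p] the scaled recurrence reads [beta k + beta (k - 1) = 0], because
    [alpha 0 = alpha 1 = 1] and the other [alpha] vanish. Hence [beta k] is congruent to the unit
    [(-1) ^ k]. *)
Lemma gen_bernoulli_neq_0 (N : nat) (B : nat -> R) (m : nat) : (1 <= N)%nat ->
  is_gen_bernoulli N B -> (m < N)%nat -> B m <> 0.
Proof.
intros HN HB Hm.
assert (Rec := gen_bernoulli_rec N B HN HB).
set (n := S N) in *.
destruct (PrimePower.pow_fact_quotient_nat (n := n)) as [p [p1 [pe Hq]]]; [unfold n; lia|].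
set (beta := fun j => INR n ^ j * (B j / INR (fact j))).
set (alpha := fun k => INR n ^ k * tail_coef N k).
assert (Hn : INR n <> 0) by (apply not_0_INR; unfold n; lia).
assert (a0 : alpha 0%nat = 1).
{ unfold alpha, tail_coef; rewrite Nat.add_0_r; simpl pow; field; apply INR_fact_neq_0. }
assert (a1 : alpha 1%nat = 1).
{ unfold alpha, tail_coef; rewrite Nat.add_1_r; fold n; rewrite pow_1.
  unfold n at 2; rewrite fact_simpl, mult_INR; fold n; field; split; auto using INR_fact_neq_0. }
(* As [(N + 1)! = n N!], [alpha k = n^{k-1} n! / (n + k - 1)!]; the divisibility is used at
   [L = k - 1], which lies strictly between 0 and [n]. *)
assert (aL : forall k, (2 <= k)%nat -> (k <= N)%nat -> in_local_ideal p (Z.of_nat p) (alpha k)).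
{ intros k H2 HkN; destruct (Hq (k - 1)%nat ltac:(lia) ltac:(unfold n; lia)) as [u [w [Hu E]]].
  exists (Z.of_nat w), u; split; [exact Hu|].
  apply (f_equal INR) in E; rewrite !mult_INR, pow_INR in E.
  rewrite mult_IZR, <- !INR_IZR_INZ.
  apply Rmult_eq_reg_r with (INR (fact (n + (k - 1)))); [|apply INR_fact_neq_0].
  rewrite <- E; unfold alpha, tail_coef.
  replace (N + k)%nat with (n + (k - 1))%nat by (unfold n; lia).
  replace (INR (fact n)) with (INR n * INR (fact N)) by (unfold n; rewrite fact_simpl, mult_INR; ring).
  replace (INR n ^ k) with (INR n * INR n ^ (k - 1)).
  - field; apply INR_fact_neq_0.
  - replace k with (S (k - 1)) at 2 by lia; reflexivity. }
assert (Rb : forall k, sum_f_R0 (fun j => beta j * alpha (k - j)%nat) k =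
  match k with O => 1 | S _ => 0 end).
{ intros k; rewrite (sum_eq _ (fun j => (B j / INR (fact j) * tail_coef N (k - j)) * INR n ^ k)).
  - rewrite <- scal_sum, Rec; destruct k; simpl; ring.
  - intros j Hj; unfold beta, alpha.
    replace (INR n ^ k) with (INR n ^ j * INR n ^ (k - j)) by (rewrite <- pow_add; f_equal; lia).
    ring. }
assert (b_mod : forall k, (k < N)%nat -> in_local_ideal p (Z.of_nat p) (beta k - (-1) ^ k)).
{ induction k as [k IH] using (well_founded_induction lt_wf); intros Hk.
  assert (b_int : forall j, (j < k)%nat -> in_local_ideal p 1 (beta j)).
  { intros j Hj; replace (beta j) with ((beta j - (-1) ^ j) + (-1) ^ j) by ring.
    apply in_local_ideal_plus; [exact pe| |].
    - apply in_local_ideal_weaken, IH; lia.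
    - destruct (pow_opp1_IZR j) as [s [_ ->]]; replace s with (1 * s)%Z by ring.
      apply in_local_ideal_IZR, p1. }
  specialize (Rb k); destruct k as [|k].
  - simpl in Rb; rewrite a0 in Rb; replace (beta 0%nat - (-1) ^ 0) with (IZR (Z.of_nat p * 0))
      by (rewrite Z.mul_0_r; simpl; lra).
    apply in_local_ideal_IZR, p1.
  - rewrite tech5, Nat.sub_diag, a0 in Rb.
    (* With [l < k] the index [S k - j] is at least 2, so every term lies in the ideal. The term
       [j = k], where [alpha 1 = 1], is treated apart. *)
    assert (Hsum : forall l, (l < k)%nat ->
      in_local_ideal p (Z.of_nat p) (sum_f_R0 (fun j => beta j * alpha (S k - j)%nat) l)).
    { induction l as [|l IHl]; intros Hl.
      - simpl sum_f_R0; apply in_local_ideal_mult; [exact pe|apply b_int; lia|apply aL; lia].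
      - rewrite tech5; apply in_local_ideal_plus; [exact pe|apply IHl; lia|].
        apply in_local_ideal_mult; [exact pe|apply b_int; lia|apply aL; lia]. }
    assert (IHk := IH k ltac:(lia) ltac:(lia)).
    destruct k as [|k].
    + simpl sum_f_R0 in Rb; simpl Nat.sub in Rb; rewrite a1 in Rb.
      replace (beta 1%nat - (-1) ^ 1) with (- (beta 0%nat - (-1) ^ 0)) by (simpl; lra).
      apply in_local_ideal_opp, IHk.
    + rewrite tech5 in Rb; replace (S (S k) - S k)%nat with 1%nat in Rb by lia; rewrite a1 in Rb.
      replace (beta (S (S k)) - (-1) ^ S (S k)) with
        (- (beta (S k) - (-1) ^ S k) + - sum_f_R0 (fun j => beta j * alpha (S (S k) - j)%nat) k)
        by (change ((-1) ^ S (S k)) with (-1 * (-1) ^ S k); lra).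
      apply in_local_ideal_plus; [exact pe|apply in_local_ideal_opp, IHk|].
      apply in_local_ideal_opp, Hsum; lia. }
intros E; apply (pow_opp1_notin p m).
replace ((-1) ^ m) with (- (beta m - (-1) ^ m)) by (unfold beta; rewrite E; unfold Rdiv; ring).
apply in_local_ideal_opp, b_mod, Hm.
Qed.

(** * The zeta function *)

Lemma factorable_shift (f : C -> C) (a c : C) :
  factorable f (a + c) -> factorable (fun z => f (z + c)%C) a.
Proof.
intros [q [Hq E]]; exists (fun z => q (z + c)%C); split; [apply analytic_at_shift, Hq|].
apply locally_Cmod in E; destruct E as [e E]; apply locally_Cmod; exists e; intros z Hz.
rewrite E; [f_equal; f_equal; ring|].
replace (z + c - (a + c))%C with (z - a)%C by ring; exact Hz.
Qed.

Lemma RtoC_neq (x y : R) : x <> y -> RtoC x <> RtoC y.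
Proof. intros H E; apply H, RtoC_inj, E. Qed.

Lemma Cpoch_neq_0 (s : C) (k : nat) :
  (forall j, (j < k)%nat -> (s + RtoC (INR j))%C <> RtoC 0) -> Cpoch s k <> RtoC 0.
Proof.
induction k as [|k IH]; intros H.
- apply RtoC_neq; lra.
- apply Cmult_neq_0; [apply IH; intros j Hj; apply H; lia|apply H; lia].
Qed.

(** The cofactor of [s + m] in the product, defined without division. It does not vanish at
    [s = - m], so its reciprocal is regular there and the whole pole sits in [/ (s + m)]. *)
Fixpoint Cpoch_omit (m : nat) (s : C) (k : nat) : C :=
  match k with
  | O => RtoC 1
  | S k' => (Cpoch_omit m s k' * (if Nat.eqb k' m then 1 else s + RtoC (INR k')))%C
  end.

Lemma Cpoch_omit_le (m : nat) (s : C) (k : nat) : (k <= m)%nat -> Cpoch_omit m s k = Cpoch s k.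
Proof.
induction k as [|k IH]; intros Hk; [reflexivity|].
simpl; rewrite IH by lia; rewrite (proj2 (Nat.eqb_neq k m)) by lia; reflexivity.
Qed.

Lemma Cpoch_omitE (m : nat) (s : C) (i : nat) :
  Cpoch s (S m + i) = ((s + RtoC (INR m)) * Cpoch_omit m s (S m + i))%C.
Proof.
induction i as [|i IH].
- rewrite Nat.add_0_r; simpl; rewrite Nat.eqb_refl, Cpoch_omit_le by lia; ring.
- rewrite Nat.add_succ_r; cbn [Cpoch Cpoch_omit]; rewrite IH.
  rewrite (proj2 (Nat.eqb_neq (S m + i) m)) by lia; ring.
Qed.

(** The factors before the omitted one multiply to [(-1)^m m!], those after it to [i!]. *)
Lemma Cpoch_omit_root (m i : nat) :
  Cpoch_omit m (- RtoC (INR m)) (S m + i) = RtoC ((-1) ^ m * INR (fact m) * INR (fact i)).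
Proof.
induction i as [|i IH].
- rewrite Nat.add_0_r; cbn [Cpoch_omit].
  rewrite Nat.eqb_refl, Cpoch_omit_le, Cpoch_neg, Nat.sub_diag by lia.
  rewrite Cmult_1_r; f_equal; simpl; field.
- rewrite Nat.add_succ_r; cbn [Cpoch_omit]; rewrite IH.
  rewrite (proj2 (Nat.eqb_neq (S m + i) m)) by lia.
  rewrite fact_simpl, mult_INR.
  replace (- RtoC (INR m) + RtoC (INR (S m + i)))%C with (RtoC (INR (S i))).
  + rewrite <- RtoC_mult; f_equal; ring.
  + rewrite <- RtoC_opp, <- RtoC_plus; f_equal; rewrite plus_INR, !S_INR; ring.
Qed.

Lemma factorable_Cpoch_omit (m k : nat) (a : C) : factorable (fun s => Cpoch_omit m s k) a.
Proof.
induction k as [|k IH]; [apply (factorable_const (RtoC 1))|].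
apply (factorable_mult _ (fun s => if Nat.eqb k m then 1 else s + RtoC (INR k))%C); [exact IH|].
destruct (Nat.eqb k m); [apply (factorable_const (RtoC 1))|].
apply factorable_plus; [apply factorable_id|apply factorable_const].
Qed.

Definition zeta_ext (N : nat) (d : nat -> R) (s : C) : C :=
  (RtoC (INR (fact N)) * (mellin_ratio (gen_fun N) d (s - 1) * / Cpoch (s - 1) N))%C.

(** The integrand of [zeta] is [N! x^{s-2} phi(x)], with integral [N!] times the Mellin transform at
    [s - 1], and [Gamma (s + N - 1) = Cpoch (s - 1) N * Gamma (s - 1)]. *)
Lemma zeta_ext_eq (N : nat) (d : nat -> R) (s : C) : (1 <= N)%nat ->
  exp_series_at_0 (gen_fun N) d -> 1 < Re s -> zeta_ext N d s = zeta N s.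
Proof.
intros HN Hd Hs.
assert (Hw : 0 < Re (s - 1)%C) by (unfold Re in *; simpl; lra).
assert (Hf := exp_decay_gen_fun N HN).
unfold zeta_ext, zeta; rewrite mellin_ratio_init by assumption.
replace (s + INR N - 1)%C with (s - 1 + RtoC (INR N))%C by ring.
rewrite Gamma_poch by exact Hw.
rewrite (is_int0_unique _ (RtoC (INR (fact N)) * Mellin (gen_fun N) (s - 1))%C).
- assert (HG := Gamma_neq_0 _ Hw).
  assert (HP : Cpoch (s - 1) N <> RtoC 0).
  { apply Cpoch_neq_0; intros j _ E; apply (f_equal Re) in E.
    assert (H := pos_INR j); unfold Re in *; simpl in *; lra. }
  field; auto.
- generalize (is_int0_Cmult _ (RtoC (INR (fact N))) _ (is_int0_Mellin _ _ Hf Hw)).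
  apply is_int0_ext; intros x Hx.
  assert (Hp := exp_sub_T_pos N x HN Hx).
  replace (s + INR N - 2)%C with (s - 1 - 1 + RtoC (INR N))%C by ring.
  rewrite Rcpow_plus, Rcpow_RtoC, exp_INR_ln by exact Hx.
  unfold gen_fun, Rdiv, Cdiv; rewrite !RtoC_mult, !RtoC_inv by (try apply INR_fact_neq_0; lra).
  assert (H1 : RtoC (INR (fact N)) <> RtoC 0) by apply RtoC_neq, INR_fact_neq_0.
  assert (H2 : RtoC (exp x - T (N - 1) x) <> RtoC 0) by (apply RtoC_neq; lra).
  fieldC; auto.
Qed.

Lemma zeta_ext_analytic (N : nat) (d : nat -> R) (s : C) : (1 <= N)%nat ->
  exp_series_at_0 (gen_fun N) d ->
  (forall j, (j < N)%nat -> (s - 1 + RtoC (INR j))%C <> RtoC 0) ->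
  analytic_at (zeta_ext N d) s.
Proof.
intros HN Hd Hs; apply analytic_at_mult; [apply analytic_at_const|].
apply analytic_at_mult.
- apply analytic_at_shift, analytic_at_mellin_ratio; [apply exp_decay_gen_fun, HN|exact Hd].
- apply (analytic_at_inv (fun s => Cpoch (s - 1) N)); [|apply Cpoch_neq_0, Hs].
  apply (analytic_at_shift (fun s => Cpoch s N)), factorable_analytic, factorable_Cpoch.
Qed.

(** [Cpoch (z - 1) N] is [z - a] times a cofactor [g]. The quotient of [mellin_ratio] by [g] is its
    value at [a] plus [z - a] times an analytic function, so dividing by [z - a] displays the
    principal part. The residue [N! B_m / (m! (N - m - 1)!)] is rewritten with a binomial
    coefficient. *)
Lemma zeta_ext_pole (N m : nat) (B d : nat -> R) (a : C) : (m < N)%nat ->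
  is_gen_bernoulli N B -> exp_series_at_0 (gen_fun N) d ->
  mellin_ratio (gen_fun N) d (- RtoC (INR m)) = RtoC ((-1) ^ m * B m) ->
  (a - 1)%C = (- RtoC (INR m))%C ->
  simple_pole_residue (zeta_ext N d) a
    (RtoC (INR (S m) * Binomial.C N (S m) * B m)).
Proof.
intros Hm HB Hd HH Ha.
assert (HN : (1 <= N)%nat) by lia.
assert (HBm := gen_bernoulli_neq_0 N B m HN HB Hm).
set (i := (N - S m)%nat); assert (EN : N = (S m + i)%nat) by (unfold i; lia).
assert (Hfm := INR_fact_neq_0 m); assert (Hfi := INR_fact_neq_0 i);
assert (HfN := INR_fact_neq_0 N).
assert (Hs : (-1) ^ m <> 0) by (apply pow_nonzero; lra).
assert (HSm : INR (S m) <> 0) by (apply not_0_INR; lia).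
assert (Er : INR (S m) * Binomial.C N (S m) * B m =
  INR (fact N) * ((-1) ^ m * B m / ((-1) ^ m * INR (fact m) * INR (fact i)))).
{ unfold Binomial.C; fold i; rewrite (fact_simpl m), mult_INR; field; auto. }
split.
{ rewrite Er; apply RtoC_neq; apply Rmult_integral_contrapositive_currified; [exact HfN|].
  apply Rmult_integral_contrapositive_currified.
  - apply Rmult_integral_contrapositive_currified; assumption.
  - apply Rinv_neq_0_compat; repeat apply Rmult_integral_contrapositive_currified; assumption. }
set (g := fun s => Cpoch_omit m s N).
assert (Hg : g (a - 1)%C = RtoC ((-1) ^ m * INR (fact m) * INR (fact i))).
{ unfold g; rewrite Ha, EN; apply Cpoch_omit_root. }
assert (Hg0 : g (a - 1)%C <> RtoC 0).
{ rewrite Hg; apply RtoC_neq; repeat apply Rmult_integral_contrapositive_currified; assumption. }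
assert (F : factorable (fun s => mellin_ratio (gen_fun N) d (s - 1) * / g (s - 1))%C a).
{ apply (factorable_shift (fun w => mellin_ratio (gen_fun N) d w * / g w)%C a (- (1))%C).
  apply factorable_mult.
  - change (a + - (1))%C with (a - 1)%C; rewrite Ha.
    apply factorable_mellin_ratio; [apply exp_decay_gen_fun, HN|exact Hd].
  - apply factorable_inv; [apply factorable_Cpoch_omit|exact Hg0]. }
destruct F as [q [Hq E]].
exists (fun z => RtoC (INR (fact N)) * q z)%C; split.
{ apply analytic_at_mult; [apply analytic_at_const|exact Hq]. }
assert (Hgn : locally a (fun z => g (z - 1)%C <> RtoC 0)).
{ apply (analytic_at_continuous (fun z => g (z - 1)%C) a) with (2 := locally_neq_0 _ Hg0).
  apply (analytic_at_shift g), factorable_analytic, factorable_Cpoch_omit. }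
generalize (filter_and (F := locallyC a) _ _ E Hgn).
apply (filter_imp (F := locallyC a)); intros z [Ez Hgz] Hz.
change C in (type of z).
assert (Hza : (z - a)%C <> RtoC 0).
{ intros E0; apply Hz; transitivity (z - a + a)%C; [ringC|rewrite E0; ringC]. }
assert (EP : Cpoch (z - 1) N = ((z - a) * g (z - 1))%C).
{ unfold g; rewrite EN, Cpoch_omitE; f_equal.
  replace (RtoC (INR m)) with (- (a - 1))%C by (rewrite Ha; ring); ring. }
unfold zeta_ext; rewrite EP, Er.
transitivity (RtoC (INR (fact N)) * (mellin_ratio (gen_fun N) d (z - 1) * / g (z - 1)) / (z - a))%C.
{ field; auto. }
rewrite Ez, Hg, Ha, HH.
assert (H1 : RtoC ((-1) ^ m * INR (fact m) * INR (fact i)) <> RtoC 0).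
{ apply RtoC_neq; repeat apply Rmult_integral_contrapositive_currified; assumption. }
unfold Rdiv; rewrite (RtoC_mult (INR (fact N))), (RtoC_mult ((-1) ^ m * B m)), RtoC_inv
  by (repeat apply Rmult_integral_contrapositive_currified; assumption).
field; auto.
Qed.

(** For [N <= m] the denominator is [(- m)_N = (-1)^N m! / (m - N)!], which is nonzero and yields
    the inverse binomial coefficient. *)
Lemma zeta_ext_neg (N m : nat) (B d : nat -> R) (s : C) : (N <= m)%nat ->
  mellin_ratio (gen_fun N) d (- RtoC (INR m)) = RtoC ((-1) ^ m * B m) ->
  (s - 1)%C = (- RtoC (INR m))%C ->
  zeta_ext N d s = RtoC ((-1) ^ (m - N) * / Binomial.C m N * B m).
Proof.
intros Hm HH Hs; unfold zeta_ext; rewrite Hs, HH, Cpoch_neg by exact Hm.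
assert (Hfm := INR_fact_neq_0 m); assert (HfN := INR_fact_neq_0 N).
assert (Hfi := INR_fact_neq_0 (m - N)).
assert (HsN : (-1) ^ N <> 0) by (apply pow_nonzero; lra).
assert (Hd : (-1) ^ N * (INR (fact m) / INR (fact (m - N))) <> 0).
{ apply Rmult_integral_contrapositive_currified; [exact HsN|].
  apply Rmult_integral_contrapositive_currified; [exact Hfm|].
  apply Rinv_neq_0_compat, Hfi. }
rewrite <- RtoC_inv, <- !RtoC_mult by exact Hd; f_equal.
unfold Binomial.C; replace ((-1) ^ m) with ((-1) ^ (m - N) * (-1) ^ N)
  by (rewrite <- pow_add; f_equal; lia).
field; auto.
Qed.

Lemma RtoC_IZR_sub1 (n : Z) (m : nat) : (Z.of_nat m = 1 - n)%Z ->
  (RtoC (IZR n) - 1)%C = (- RtoC (INR m))%C.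
Proof.
intros H; rewrite INR_IZR_INZ, H, minus_IZR, RtoC_minus; ring.
Qed.

Theorem theorem3p3 (N : nat) (hN : (1 <= N)%nat)
    (B : nat -> R) (hB : is_gen_bernoulli N B) :
  exists F : C -> C,
    (forall s : C, 1 < Re s -> F s = zeta N s) /\
    (forall s : C,
       (forall n : Z, (2 - Z.of_nat N <= n <= 1)%Z -> s <> RtoC (IZR n)) ->
       analytic_at F s) /\
    (forall n : Z, (2 - Z.of_nat N <= n <= 1)%Z ->
       simple_pole_residue F (RtoC (IZR n))
         (RtoC (IZR (2 - n) * Binomial.C N (Z.to_nat (2 - n))
                * B (Z.to_nat (1 - n))))) /\
    (forall n : Z, (n < 2 - Z.of_nat N)%Z ->
       F (RtoC (IZR n)) =
         RtoC (powerRZ (-1) (- n - Z.of_nat N + 1)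
               * / Binomial.C (Z.to_nat (1 - n)) N
               * B (Z.to_nat (1 - n)))).
Proof.
destruct (mellin_ratio_gen_fun_neg N B hN hB) as [d [Hd HH]].
exists (zeta_ext N d); split; [|split; [|split]].
- intros s Hs; apply zeta_ext_eq; assumption.
- intros s Hs; apply zeta_ext_analytic; [exact hN|exact Hd|].
  intros j Hj E; apply (Hs (1 - Z.of_nat j)%Z); [lia|].
  rewrite minus_IZR, <- INR_IZR_INZ, RtoC_minus.
  transitivity (s - 1 + RtoC (INR j) + (1 - RtoC (INR j)))%C; [ring|rewrite E; ring].
- intros n Hn; set (m := Z.to_nat (1 - n)).
  assert (Em : (Z.of_nat m = 1 - n)%Z) by (unfold m; lia).
  replace (Z.to_nat (2 - n)) with (S m) by lia.
  replace (IZR (2 - n)) with (INR (S m)) by (rewrite INR_IZR_INZ; f_equal; lia).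
  apply zeta_ext_pole; auto; [lia|apply RtoC_IZR_sub1, Em].
- intros n Hn; set (m := Z.to_nat (1 - n)).
  assert (Em : (Z.of_nat m = 1 - n)%Z) by (unfold m; lia).
  rewrite (zeta_ext_neg N m B d) by (auto using RtoC_IZR_sub1; lia).
  (* Since [n < 2 - N] means [N <= m], the subtraction in [nat] is exact. *)
  replace (- n - Z.of_nat N + 1)%Z with (Z.of_nat (m - N)) by lia.
  rewrite <- pow_powerRZ; reflexivity.
Qed.
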